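(* Let $G$ be a topological group, let $\Omega$ be a $G$-skeleton with the ED and minimality properties, and write $Y:=X_\Omega$ for its folded flow. The following are equivalent: (1) $\Omega$ has the Ramsey property. (2) $\Omega$ has the strong Ramsey property. (3) $\Omega$ is finitely oscillation stable. (4) $\Omega$ is weakly finitely oscillation stable. (5) $Y\cong\mathrm{M}(G)$ (as $G$-flows).
   Context: All topological spaces are Hausdorff and regular; metrics and pseudometrics may take the value $\infty$. A $G$-flow is a compact space with continuous left $G$-action; $\mathrm{M}(G)$ is the universal minimal flow (the unique minimal $G$-flow, i.e. with all orbits dense, mapping continuously and equivariantly onto every minimal $G$-flow). Semi-norms. $\mathrm{SN}(G)$ is the set of bounded continuous $\sigma\colon G\to[0,\infty)$ with $\sigma(e_G)=0$, $\sigma(g)=\sigma(g^{-1})$, $\sigma(gh)\le\sigma(g)+\sigma(h)$, ordered pointwise, with join the pointwise maximum, and with right $G$-action $(\sigma g)(h)=\sigma(ghg^{-1})$. A base of semi-norms is $\mathcal{S}\subseteq\mathrm{SN}(G)$ such that the sets $\{g:\sigma(g)<c\}$ ($\sigma\in\mathcal{S},c>0$) form a neighborhood base at $e_G$. A $G$-join-semi-lattice is a join semi-lattice $\mathcal{B}$ with a right $G$-action by automorphisms; for $\sigma\in\mathcal{B}$ and finite nonempty $F\subseteq G$ put $\sigma F=\bigvee_{g\in F}\sigma g$, and for $\sigma,\tau\in\mathcal{B}$ put $\mathrm{P}(\tau,\sigma)=\{g\in G:\sigma g\le\tau\}$. Skeletons. Let $\mathcal{B}$ be a $G$-join-semi-lattice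 and $\theta\colon\mathcal{B}\to\mathrm{SN}(G)$ an equivariant, order- and join-preserving map; write $\sigma(g)$ for $\theta(\sigma)(g)$ and $\mathrm{B}_\sigma(\epsilon)=\{g:\sigma(g)<\epsilon\}$. A $\theta$-skeleton $\Omega$ consists of: for each $\sigma\in\mathcal{B}$ a metric space $(X_\sigma,d_\sigma)$ (with its metric topology); for $\sigma\le\tau$ a surjection $\pi^\tau_\sigma\colon X_\tau\to X_\sigma$ with $d_\sigma(\pi^\tau_\sigma x,\pi^\tau_\sigma y)\le d_\tau(x,y)$ and $\pi^\tau_\sigma\circ\pi^\nu_\tau=\pi^\nu_\sigma$ whenever $\sigma\le\tau\le\nu$; for $\sigma\in\mathcal{B}$, $g\in G$ an isometric homeomorphism $\lambda_{g,\sigma}\colon X_{\sigma g}\to X_\sigma$ such that: (Equivariance) $\lambda_{g,\sigma}\circ\pi^{\tau g}_{\sigma g}=\pi^\tau_\sigma\circ\lambda_{g,\tau}$ for $\sigma\le\tau$; (Action) $\lambda_{g,\sigma}\circ\lambda_{h,\sigma g}=\lambda_{gh,\sigma}$; and, writing $g\cdot_\sigma x=\lambda_{g,\sigma}(\pi^\tau_{\sigma g}(x))$ for $g\in\mathrm{P}(\tau,\sigma)$, $x\in X_\tau$, (Continuity) $d_\sigma(g\cdot_\sigma x,\pi^\tau_\sigma(x))\le\sigma(g)$ whenever $\sigma\le\tau$, $g\in\mathrm{P}(\tau,\sigma)$, $x\in X_\tau$. A $G$-skeleton is a $\theta$-skeleton for some $\theta$ with $\theta[\mathcal{B}]$ a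 base of semi-norms. Folded flow. Let $\mathrm{Sa}(X_\sigma)$ be the Samuel compactification of the metric uniform space $(X_\sigma,d_\sigma)$. The maps $\pi^\tau_\sigma,\lambda_{g,\sigma}$ extend continuously to the Samuel compactifications. $X_\Omega:=\varprojlim_{\sigma\in\mathcal{B}}\mathrm{Sa}(X_\sigma)$ along the extended maps $\pi^\tau_\sigma$, with projections $\pi_\sigma\colon X_\Omega\to\mathrm{Sa}(X_\sigma)$; it is a $G$-flow with $gy$ defined by $\pi_\sigma(gy)=\lambda_{g,\sigma}(\pi_{\sigma g}(y))$ for all $\sigma$. The metric $d_\sigma$ is extended to a lower semi-continuous metric on $\mathrm{Sa}(X_\sigma)$, still denoted $d_\sigma$, by $d_\sigma(p,q)=\sup\{\inf d_\sigma(A\cap X_\sigma,B\cap X_\sigma)\}$, the supremum over open neighborhoods $A\ni p$, $B\ni q$. Minimality property: for every $\sigma\in\mathcal{B}$ and nonempty open $A\subseteq X_\sigma$ there is a finite $F\subseteq G$ such that for every $y\in X_{\sigma F}$ there is $g\in F$ with $g\cdot_\sigma y\in A$. ED property: (i) for every $\sigma$, $\overline{A}\subseteq\mathrm{Int}(\overline{\{z:d_\sigma(A,z)<c\}})$ for all nonempty open $A\subseteq X_\sigma$, $c>0$; (ii) for $\sigma\le\tau$, with respect to the pseudometric $(x,y)\mapsto d_\sigma(\pi^\tau_\sigma x,\pi^\tau_\sigma y)$ on $X_\tau$, for every open $A\subseteq X_\tau$ and $c>0$ the set of points at distance $<c$ from some point of $A$ is open; (iii) whenever $\sigma\le\tau$,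 $0<\epsilon<1$, and $A,B\subseteq X_\tau$ are nonempty open with $\inf\{d_\sigma(\pi^\tau_\sigma x,\pi^\tau_\sigma y):x\in A,y\in B\}<\epsilon$, there is $g\in\mathrm{B}_\sigma(\epsilon)$ such that for every $\upsilon\in\mathcal{B}$ with $\tau\le\upsilon$ and $g\in\mathrm{P}(\upsilon,\tau)$, $(\pi^\upsilon_\tau)^{-1}[A]\cap(\lambda_{g,\tau}\circ\pi^\upsilon_{\tau g})^{-1}[B]\ne\emptyset$. For $D\subseteq G$ let $\mathrm{C}_\sigma(D,[0,1])$ be the set of $f\colon D\to[0,1]$ with $|f(g)-f(h)|\le\sigma(gh^{-1})$ for $g,h\in D$. For $x\in X_\sigma$, $x'\in X_\tau$, $\epsilon>0$ let $\mathrm{P}(x',x,\epsilon)=\{h\in\mathrm{P}(\tau,\sigma):d_\sigma(h\cdot_\sigma x',x)<\epsilon\}$; for $y\in X_\Omega$ let $\mathrm{P}(y,x,\epsilon)=\{h\in G:d_\sigma(\pi_\sigma(hy),x)<\epsilon\}$. $\mathrm{Sa}(G)$ is the Samuel compactification of $G$ for its right uniformity (entourages $\{(g,h):g\in Uh\}$); for $p\in\mathrm{Sa}(G)$, a $G$-flow $X$ and $y\in X$, $py=\lim_{g\to p}gy$; for $f\in\mathrm{C}_\sigma(G,[0,1])$, $(p\cdot f)(g)=\lim_{h\to p}f(gh)$. Ramsey property: for all $\sigma\in\mathcal{B}$, $x\in X_\sigma$, $\epsilon,\delta>0$, finite $F\subseteq G$ there are $\tau\in\mathcal{B}$, $x'\in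 X_\tau$ such that for every $f\in\mathrm{C}_\sigma(G,[0,1])$ there is $h\in G$ with $Fh\subseteq\mathrm{P}(\tau,\sigma)$ and $\mathrm{diam}(f[Fh\cap\mathrm{P}(x',x,\epsilon)])<2\epsilon+\delta$. Strong Ramsey property: for all $\sigma$, $x\in X_\sigma$, $\epsilon,\delta>0$, finite $F\subseteq G$ there are $\tau\in\mathcal{B}$ and finite $S\subseteq G$ such that for all $x'\in X_\tau$ and $f\in\mathrm{C}_\sigma(FS,[0,1])$ there is $h\in S$ with $Fh\subseteq\mathrm{P}(\tau,\sigma)$ and $\mathrm{diam}(f[Fh\cap\mathrm{P}(x',x,\epsilon)])<2\epsilon+\delta$. Finitely oscillation stable: for all $y\in X_\Omega$, $\sigma\in\mathcal{B}$, $x\in X_\sigma$, $\epsilon>0$, $f\in\mathrm{C}_\sigma(G,[0,1])$ there is $p\in\mathrm{Sa}(G)$ with $\mathrm{diam}((p\cdot f)[\mathrm{P}(py,x,\epsilon)])\le2\epsilon$. Weakly finitely oscillation stable: there is $y\in X_\Omega$ such that for all $\sigma\in\mathcal{B}$, $x\in X_\sigma$, $\epsilon>0$, $f\in\mathrm{C}_\sigma(G,[0,1])$ there is $p\in\mathrm{Sa}(G)$ with $\mathrm{diam}((p\cdot f)[\mathrm{P}(py,x,\epsilon)])\le2\epsilon$. *)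

(* Defs.v *)
From HB Require Import structures.
From mathcomp Require Import all_boot all_order all_algebra finmap.
From mathcomp Require Import all_classical all_reals.
From mathcomp Require Import ereal topology normedtype.

Set Implicit Arguments.
Unset Strict Implicit.
Unset Printing Implicit Defensive.

Import Order.TTheory GRing.Theory Num.Theory.
Import numFieldNormedType.Exports.

Local Open Scope classical_set_scope.
Local Open Scope ring_scope.

HB.mixin Record Group_isTopologicalGroup G & Topological G & Group G := {
  mulg_continuous : continuous (fun gh : G * G => (gh.1 * gh.2)%g);
  invg_continuous : continuous (fun g : G => (g^-1)%g)
}.

#[short(type="topologicalGroupType")]
HB.structure Definition TopologicalGroup :=
  {G of Topological G & Group G & Group_isTopologicalGroup G}.

Definition homeomorphism (X Y : topologicalType) (f : X -> Y) : Prop :=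
  continuous f /\
  exists f' : Y -> X, [/\ cancel f f', cancel f' f & continuous f'].

Section Flows.
Context {G : topologicalGroupType}.

(* Flows are nonempty: otherwise the empty flow would vacuously be minimal and
   no minimal flow could map onto every minimal flow. *)
Record is_flow (X : topologicalType) (act : G -> X -> X) : Prop := IsFlow {
  flow_nonempty : [set: X] !=set0;
  flow_compact : compact [set: X];
  flow_hausdorff : hausdorff_space X;
  flow_act1 : forall x, act 1%g x = x;
  flow_actM : forall g h x, act (g * h)%g x = act g (act h x);
  flow_continuous : continuous (fun gx : G * X => act gx.1 gx.2)
}.

Definition minimal_flow (X : topologicalType) (act : G -> X -> X) : Prop :=
  is_flow act /\ forall x, dense (range (act^~ x)).

Definition equivariant (X Y : Type) (actX : G -> X -> X) (actY : G -> Y -> Y)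
    (f : X -> Y) : Prop :=
  forall g x, f (actX g x) = actY g (f x).

Definition universal_minimal_flow (M : topologicalType) (act : G -> M -> M) :
    Prop :=
  minimal_flow act /\
  forall (N : topologicalType) (actN : G -> N -> N), minimal_flow actN ->
    exists f : M -> N,
      [/\ continuous f, equivariant act actN f & set_surj setT setT f].

Definition flow_iso (X Y : topologicalType) (actX : G -> X -> X)
    (actY : G -> Y -> Y) : Prop :=
  exists f : X -> Y, homeomorphism f /\ equivariant actX actY f.

End Flows.

Definition right_uniform (G : topologicalGroupType) : Type := G.

Section RightUniformity.
Context (G : topologicalGroupType).

(* g \in U h is written g * h^-1 \in U. *)
Definition right_entourage : set_system (G * G) :=
  filter_from (nbhs (1%g : G))
    (fun U => [set gh | U (gh.1 * gh.2^-1)%g]).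

HB.instance Definition _ := Topological.on (right_uniform G).

Let right_entourage_filter : Filter right_entourage.
Proof.
apply: filter_from_filter; first by exists setT; exact: filterT.
by move=> U V nU nV; exists (U `&` V); first exact: filterI.
Qed.

Let right_entourage_refl A : right_entourage A -> diagonal `<=` A.
Proof.
move=> [U nU UA] [g h] /diagonalP ->; apply: UA => /=.
by rewrite mulgV; exact: nbhs_singleton.
Qed.

Let right_entourage_inv A :
  right_entourage A -> right_entourage (A^-1)%relation.
Proof.
move=> [U nU UA]; exists [set g | U (g^-1)%g].
  have := @invg_continuous G 1%g U; rewrite invg1; exact.
by move=> [g h] /= Ugh; apply: UA => /=; rewrite invgF in Ugh.
Qed.

Let right_entourage_split A : right_entourage A ->
  exists2 C, right_entourage C & (C \; C `<=` A)%relation.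
Proof.
move=> [U nU UA].
have := @mulg_continuous G (1%g, 1%g) U; rewrite /= mulg1 => /(_ nU).
move=> [[V W] /= [nV nW] VWU]; exists [set gh | (V `&` W) (gh.1 * gh.2^-1)%g].
  by exists (V `&` W) => //; exact: filterI.
move=> [g k] /= [h /= [Vgh Wgh] [Vhk Whk]]; apply: UA => /=.
have /VWU /= : (V `*` W) ((g * h^-1)%g, (h * k^-1)%g) by [].
by rewrite mulgA mulgVK.
Qed.

Let right_nbhsE : @nbhs _ (right_uniform G) = nbhs_ right_entourage.
Proof.
apply/funext => g; apply/seteqP; split=> A; rewrite nbhs_E.
- move=> nA.
  have cg : {for (1%g : G), continuous (fun u : G => (u^-1 * g)%g)}.
    apply: (@continuous_comp _ _ _ (fun u : G => ((u^-1)%g, g))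
      (fun gh : G * G => (gh.1 * gh.2)%g)).
      by apply: cvg_pair; [exact: invg_continuous | exact: cvg_cst].
    exact: mulg_continuous.
  have := cg A; rewrite invg1 mul1g => /(_ nA) nU.
  exists [set gh | A ((gh.1 * gh.2^-1)^-1 * g)%g].
    by exists [set u : G | A (u^-1 * g)%g].
  by move=> h /xsectionP /=; rewrite invgF mulgVK.
- move=> [E [U nU UE] EA].
  have cg : {for (g : G), continuous (fun h : G => (g * h^-1)%g)}.
    apply: (@continuous_comp _ _ _ (fun h : G => (g, (h^-1)%g))
      (fun gh : G * G => (gh.1 * gh.2)%g)).
      by apply: cvg_pair; [exact: cvg_cst | exact: invg_continuous].
    exact: mulg_continuous.
  have := cg U; rewrite mulgV => /(_ nU) nV.
  apply: (@filterS G (nbhs (g : G)) _ _ _ _ nV) => h Uh; apply/EA/xsectionP; exact: (UE (g, h)).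
Qed.

HB.instance Definition _ := Nbhs_isUniform_mixin.Build (right_uniform G)
  right_entourage_filter right_entourage_refl right_entourage_inv
  right_entourage_split right_nbhsE.

End RightUniformity.

Lemma prod_topology_proj_continuous (I : Type) (T : I -> topologicalType)
  (i : I) : continuous (fun y : prod_topology T => y i).
Proof.
move=> y; have /cvg_sup/(_ i) cy : y --> y by exact: cvg_id.
move=> A nA; apply: cy.
exact: (@initial_continuous _ _ (fun z : prod_topology T => z i) y A nA).
Qed.

Lemma prod_topology_continuous (X : topologicalType) (I : Type)
    (T : I -> topologicalType) (f : X -> prod_topology T) :
  (forall i, continuous (fun x => f x i)) -> continuous f.
Proof.
move=> cf x; apply/cvg_sup => i.
exact: (@continuous_comp_initial _ X _ (fun z : prod_topology T => z i) f (cf i) x).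
Qed.

Section Samuel.
Context (R : realType).

Definition ucfun01 (U : uniformType) : Type :=
  {f : U -> R | unif_continuous f /\ forall x, 0 <= f x <= 1}.

Definition sa_eval (U : uniformType) (x : U) :
  prod_topology (fun _ : ucfun01 U => R) := fun f => sval f x.

(* The closure of the image of U in the power of [0,1] indexed by the uniformly
   continuous functions U -> [0,1], with the subspace topology. *)
Definition samuel (U : uniformType) : Type := closure (range (@sa_eval U)).

HB.instance Definition _ (U : uniformType) := Topological.copy (samuel U)
  (set_type (closure (range (@sa_eval U)))).

Definition sa_in (U : uniformType) (x : U) : samuel U :=
  exist _ (sa_eval x) (mem_set (subset_closure (imageT (@sa_eval U) x))).

Definition sa_nbhs (U : uniformType) (p : samuel U) : set_system U :=
  filter_from (nbhs p) (fun W => @sa_in U @^-1` W).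

Lemma ucfun01_comp_subproof (U V : uniformType) (phi : U -> V)
    (uphi : unif_continuous phi) (f : ucfun01 V) :
  unif_continuous (sval f \o phi) /\ forall x, 0 <= (sval f \o phi) x <= 1.
Proof.
case: f => f [uf f01] /=; split=> [A eA|x]; last exact: f01.
exact: (uphi _ (uf _ eA)).
Qed.

Definition ucfun01_comp (U V : uniformType) (phi : U -> V)
    (uphi : unif_continuous phi) (f : ucfun01 V) : ucfun01 U :=
  exist _ (sval f \o phi) (ucfun01_comp_subproof uphi f).

Lemma sa_map_subproof (U V : uniformType) (phi : U -> V)
    (uphi : unif_continuous phi) (p : samuel U) :
  (fun f => sval p (ucfun01_comp uphi f)) \in closure (range (@sa_eval V)).
Proof.
rewrite inE; have := set_mem (svalP p); move: (sval p) => {}p clp.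
pose F (q : prod_topology (fun _ : ucfun01 U => R)) :
  prod_topology (fun _ : ucfun01 V => R) :=
  fun f => q (ucfun01_comp uphi f).
have cF : continuous F.
  apply: prod_topology_continuous => f.
  exact: prod_topology_proj_continuous.
by move=> A /cF /clp[_ [[x _ <-] Ax]]; exists (sa_eval (phi x)); split=> //; exists (phi x).
Qed.

(* The continuous extension of phi; it is precomposition with phi on the
   coordinates. *)
Definition sa_map (U V : uniformType) (phi : U -> V)
    (uphi : unif_continuous phi) (p : samuel U) : samuel V :=
  exist _ (fun f => sval p (ucfun01_comp uphi f)) (sa_map_subproof uphi p).

Lemma sa_map_in (U V : uniformType) (phi : U -> V)
    (uphi : unif_continuous phi) (x : U) :
  sa_map uphi (sa_in x) = sa_in (phi x).
Proof. exact: val_inj. Qed.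

Lemma sa_map_continuous (U V : uniformType) (phi : U -> V)
    (uphi : unif_continuous phi) : continuous (sa_map uphi).
Proof.
apply: (@continuous_comp_initial _ (samuel U) _ (@set_val _ (closure (range (@sa_eval V))))).
apply: prod_topology_continuous => f p.
apply: (@continuous_comp _ _ _ (fun p : samuel U => set_val p)
  (fun q : prod_topology (fun _ : ucfun01 U => R) => q (ucfun01_comp uphi f))).
  exact: initial_continuous.
exact: prod_topology_proj_continuous.
Qed.

End Samuel.

Record is_seminorm (R : realType) (G : topologicalGroupType) (sigma : G -> R) :
    Prop := IsSeminorm {
  seminorm_continuous : continuous sigma;
  seminorm_bounded : exists M : R, forall g, sigma g <= M;
  seminorm_ge0 : forall g, 0 <= sigma g;
  seminorm1 : sigma 1%g = 0;
  seminormV : forall g, sigma (g^-1)%g = sigma g;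
  seminormM : forall g h, sigma (g * h)%g <= sigma g + sigma h
}.

(* A right action of G by automorphisms; bijectivity follows from the action
   axioms, and preservation of the order from preservation of joins. *)
Record join_action (G : groupType) (disp : Order.disp_t)
    (B : joinSemilatticeType disp) := JoinAction {
  jact :> B -> G -> B;
  jact1 : forall s, jact s 1%g = s;
  jactM : forall s g h, jact s (g * h)%g = jact (jact s g) h;
  jactU : forall s t g, jact (s `|` t)%O g = (jact s g `|` jact t g)%O
}.

Section JoinAction.
Context (G : groupType) (disp : Order.disp_t) (B : joinSemilatticeType disp).
Variable a : join_action G B.

Lemma jact_le (s t : B) (g : G) : (s <= t)%O -> (a s g <= a t g)%O.
Proof. by move=> st; rewrite -(join_r st) jactU leUl. Qed.

(* B has no bottom, so this is meaningful only for F <> fset0. *)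
Definition orbit_join (s : B) (F : {fset G}) : B :=
  if enum_fset F is g :: F' then \big[Order.join/a s g]_(h <- F') a s h else s.

Definition arrows (t s : B) : set G := [set g | (a s g <= t)%O].

End JoinAction.

Record seminorm_map (R : realType) (G : topologicalGroupType)
    (disp : Order.disp_t) (B : joinSemilatticeType disp)
    (a : join_action G B) := SeminormMap {
  snorm :> B -> G -> R;
  snormP : forall s, is_seminorm (snorm s);
  snormJ : forall s g h, snorm (a s g) h = snorm s (g * h * g^-1)%g;
  snorm_le : forall s t, (s <= t)%O -> forall g, snorm s g <= snorm t g;
  snormU : forall s t g,
    snorm (s `|` t)%O g = Num.max (snorm s g) (snorm t g)
}.

Definition seminorm_base (R : realType) (G : topologicalGroupType)
    (S : set (G -> R)) : Prop :=
  S `<=` [set sigma | is_seminorm sigma] /\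
  forall U : set G, nbhs (1%g : G) U <->
    exists sigma c, [/\ S sigma, 0 < c & [set g | sigma g < c] `<=` U].

(* A metric space whose metric may take the value +oo is a Hausdorff
   pseudoMetricType; its metric is edist. The spaces are required to be
   nonempty, as all flows are. *)
Record skeleton (R : realType) (G : topologicalGroupType) (disp : Order.disp_t)
    (B : joinSemilatticeType disp) (a : join_action G B)
    (theta : seminorm_map R a) := Skeleton {
  skel :> B -> pseudoMetricType R;
  skel_hausdorff : forall s, hausdorff_space (skel s);
  skel_nonempty : forall s, [set: skel s] !=set0;
  skel_pi : forall s t : B, (s <= t)%O -> skel t -> skel s;
  skel_pi_surj : forall s t (st : (s <= t)%O),
    set_surj setT setT (skel_pi st);
  skel_pi_lip : forall s t (st : (s <= t)%O) (x y : skel t),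
    (edist (skel_pi st x, skel_pi st y) <= edist (x, y))%E;
  skel_pi_comp : forall s t u (st : (s <= t)%O) (tu : (t <= u)%O)
      (su : (s <= u)%O) (x : skel u),
    skel_pi st (skel_pi tu x) = skel_pi su x;
  skel_lam : forall (g : G) (s : B), skel (a s g) -> skel s;
  skel_lam_homeo : forall g s, homeomorphism (@skel_lam g s);
  skel_lam_isom : forall g s (x y : skel (a s g)),
    edist (skel_lam x, skel_lam y) = edist (x, y);
  skel_equivariance : forall g s t (st : (s <= t)%O)
      (sgtg : (a s g <= a t g)%O) (x : skel (a t g)),
    skel_lam (skel_pi sgtg x) = skel_pi st (skel_lam x);
  skel_action : forall g h s (x : skel (a s (g * h)%g)),
    skel_lam (skel_lam (ecast u (skel u) (jactM a s g h) x)) = skel_lam x;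
  skel_continuity : forall g s t (st : (s <= t)%O) (sgt : (a s g <= t)%O)
      (x : skel t),
    (edist (skel_lam (skel_pi sgt x), skel_pi st x) <= (theta s g)%:E)%E
}.

Lemma edist_lip_unif_continuous (R : realType) (X Y : pseudoMetricType R)
    (f : X -> Y) :
  (forall x y, (edist (f x, f y) <= edist (x, y))%E) -> unif_continuous f.
Proof.
move=> lf; apply/unif_continuousP => e e0; exists (e / 2); first exact: divr_gt0.
move=> [x y] /= bxy; apply: (@edist_lt_ball _ _ _ (f x, f y)).
apply: le_lt_trans (lf x y) _; apply: (@le_lt_trans _ _ (e / 2)%:E).
  by apply: edist_fin; first exact: divr_gt0.
by rewrite lte_fin gtr_pMr// invf_lt1// ltr1n.
Qed.

Section Skeleton.
Context {R : realType} {G : topologicalGroupType} {disp : Order.disp_t}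
  {B : joinSemilatticeType disp} {a : join_action G B}
  {theta : seminorm_map R a}.
Variable Om : skeleton theta.

Definition skel_act (s t : B) (g : G) (sgt : (a s g <= t)%O) (x : Om t) : Om s :=
  skel_lam (skel_pi sgt x).

Definition minimality_property : Prop :=
  forall (s : B) (A : set (Om s)), open A -> A !=set0 ->
  exists F : {fset G}, F <> fset0 /\
    forall y : Om (orbit_join a s F),
    exists g (sgF : (a s g <= orbit_join a s F)%O),
      g \in F /\ A (skel_act sgF y).

Definition ed_property1 : Prop :=
  forall (s : B) (A : set (Om s)) (c : R), open A -> A !=set0 -> 0 < c ->
  closure A `<=` interior (closure [set z | (edist_inf A z < c%:E)%E]).

Definition ed_property2 : Prop :=
  forall (s t : B) (st : (s <= t)%O) (A : set (Om t)) (c : R),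
  open A -> 0 < c ->
  open [set z | exists2 x, A x &
    (edist (skel_pi st x, skel_pi st z) < c%:E)%E].

Definition ed_property3 : Prop :=
  forall (s t : B) (st : (s <= t)%O) (e : R) (A C : set (Om t)),
  0 < e < 1 -> open A -> A !=set0 -> open C -> C !=set0 ->
  (ereal_inf [set edist (skel_pi st x, skel_pi st y) | x in A & y in C]
     < e%:E)%E ->
  exists2 g : G, theta s g < e &
    forall (u : B) (tu : (t <= u)%O) (tgu : (a t g <= u)%O),
      (skel_pi tu @^-1` A `&` skel_act tgu @^-1` C) !=set0.

Definition ed_property : Prop :=
  [/\ ed_property1, ed_property2 & ed_property3].

Lemma skel_pi_unif (s t : B) (st : (s <= t)%O) :
  unif_continuous (skel_pi st : Om t -> Om s).
Proof. exact/edist_lip_unif_continuous/skel_pi_lip. Qed.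

Lemma skel_lam_unif (g : G) (s : B) :
  unif_continuous (@skel_lam _ _ _ _ _ _ Om g s : Om (a s g) -> Om s).
Proof.
by apply: edist_lip_unif_continuous => x y; rewrite skel_lam_isom.
Qed.

Arguments skel_lam_unif : clear implicits.

Definition folded_set : set (prod_topology (fun s : B => samuel R (Om s))) :=
  [set y | forall s t (st : (s <= t)%O), sa_map (skel_pi_unif st) (y t) = y s].

Definition folded : Type := folded_set.

HB.instance Definition _ := Topological.copy folded (set_type folded_set).

Definition folded_proj (s : B) (y : folded) : samuel R (Om s) := sval y s.

Lemma folded_act_subproof (g : G) (y : folded) :
  (fun s => sa_map (skel_lam_unif g s) (folded_proj (a s g) y)) \in folded_set.
Proof.
rewrite inE => s t st; have /set_mem yP := svalP y.
rewrite /folded_proj -(yP _ _ (jact_le a g st)).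
apply: val_inj => /=; apply/funext => f /=; congr (sval _ _).
apply: eq_exist => /=.
by apply/funext => x /=; rewrite skel_equivariance.
Qed.

Definition folded_act (g : G) (y : folded) : folded :=
  exist _ (fun s => sa_map (skel_lam_unif g s) (folded_proj (a s g) y))
    (folded_act_subproof g y).

Definition sa_dist (s : B) (p q : samuel R (Om s)) : \bar R :=
  ereal_sup [set m | exists A C : set (samuel R (Om s)),
    [/\ open A, A p, open C, C q &
        m = ereal_inf [set edist (x, y) | x in @sa_in R (Om s) @^-1` A
                                        & y in @sa_in R (Om s) @^-1` C]]].

(* py, the limit of gy as g -> p; the limit exists and is unique when act is a
   G-flow, so that the default value y is never used. *)
Definition sa_act (X : topologicalType) (act : G -> X -> X)
    (p : samuel R (right_uniform G)) (y : X) : X :=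
  xget y [set z | act g y @[g --> sa_nbhs p] --> z].

Definition sa_translate (p : samuel R (right_uniform G)) (f : G -> R) (g : G) :
  R := lim (f (g * h)%g @[h --> sa_nbhs p]).

Definition lip01 (s : B) (D : set G) : set (G -> R) :=
  [set f | (forall g, D g -> 0 <= f g <= 1) /\
    forall g h, D g -> D h -> `|f g - f h| <= theta s (g * h^-1)%g].

(* sup set0 = 0, so the diameter of the empty set is 0. *)
Definition diam (A : set R) : R := sup [set `|x - y| | x in A & y in A].

Definition rtranslate (F : {fset G}) (h : G) : set G :=
  [set (f * h)%g | f in [set` F]].

Definition near_arrows (s t : B) (x' : Om t) (x : Om s) (e : R) : set G :=
  [set h | exists sht : (a s h <= t)%O,
             (edist (skel_act sht x', x) < e%:E)%E].

Definition folded_near_arrows (s : B) (y : folded) (x : Om s) (e : R) : set G :=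
  [set h | (sa_dist (folded_proj s (folded_act h y)) (sa_in R x) < e%:E)%E].

Definition ramsey_property : Prop :=
  forall (s : B) (x : Om s) (e delta : R) (F : {fset G}), 0 < e -> 0 < delta ->
  exists (t : B) (x' : Om t), forall f, lip01 s setT f ->
  exists h : G, rtranslate F h `<=` arrows a t s /\
    diam (f @` (rtranslate F h `&` near_arrows x' x e)) < 2 * e + delta.

Definition strong_ramsey_property : Prop :=
  forall (s : B) (x : Om s) (e delta : R) (F : {fset G}), 0 < e -> 0 < delta ->
  exists (t : B) (S : {fset G}), forall (x' : Om t) f,
  lip01 s [set (g * h)%g | g in [set` F] & h in [set` S]] f ->
  exists h : G, [/\ h \in S, rtranslate F h `<=` arrows a t s &
    diam (f @` (rtranslate F h `&` near_arrows x' x e)) < 2 * e + delta].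

Definition oscillation_stable_at (y : folded) : Prop :=
  forall (s : B) (x : Om s) (e : R) f, 0 < e -> lip01 s setT f ->
  exists p : samuel R (right_uniform G),
    diam (sa_translate p f @` folded_near_arrows (sa_act folded_act p y) x e)
      <= 2 * e.

Definition finitely_oscillation_stable : Prop :=
  forall y : folded, oscillation_stable_at y.

Definition weakly_finitely_oscillation_stable : Prop :=
  exists y : folded, oscillation_stable_at y.

End Skeleton.

Arguments folded {R G disp B a theta} Om.
Arguments folded_act {R G disp B a theta} Om g y.
Arguments skel_lam_unif {R G disp B a theta} Om g s.
Arguments lip01 {R G disp B a} theta s D _.

(* Main.v *)
(* Let Y be the folded flow. A minimal subflow Z of Y x N, with N minimal, has
   singleton fibres over Y as soon as Y is oscillation stable at one point: for
   F in C(N), oscillation stability makes F nearly constant on the fibres over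
   the points y with pi_s(y) in X_s, these points are dense enough that
   the open sets where F is small, resp. large, on fibres have in their closures
   every point over which F takes both values, and part (iii) of the ED property
   forbids two such open sets to have intersecting closures. So Z is the graph
   of a map Y -> N and Y is universal.

   Conversely, if the strong Ramsey property fails, a compactness argument gives
   a subflow D of Y x C_s(G, [0,1]) all of whose points (y, f) oscillate.
   If Y is universal, the projection D -> Y has an equivariant section (obtained
   from an idempotent of the enveloping semigroup of D), that is, a continuous
   s-Lipschitz function on Y with the same oscillation; again part (iii) of the
   ED property shows that such a function is Lipschitz for the metric of X_s, a
   contradiction. The passage from the Ramsey property to oscillation stability
   is a limit of Ramsey witnesses in Sa(G), using that orbits in Y are dense. *)

Require Import Defs.
From HB Require Import structures.
From mathcomp Require Import all_boot all_order all_algebra finmap.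
From mathcomp Require Import all_classical all_reals.
From mathcomp Require Import ereal topology normedtype.
From mathcomp Require Import lra.

Set Implicit Arguments.
Unset Strict Implicit.
Unset Printing Implicit Defensive.

Import Order.TTheory GRing.Theory Num.Theory.
Import numFieldNormedType.Exports.

Local Open Scope classical_set_scope.
Local Open Scope ring_scope.

(** * Topology *)

Section Compactness.

Lemma compact_closed_chain (X : topologicalType) (C : set (set X)) :
  compact [set: X] -> C !=set0 -> total_on C subset ->
  (forall A, C A -> closed A) -> (forall A, C A -> A !=set0) ->
  \bigcap_(A in C) A !=set0.
Proof.
move=> cX [A0 CA0] Ctot Ccl Cn0.
have FC : Filter (filter_from C id).
  apply: filter_from_filter; first by exists A0.
  move=> A A' CA CA'; have [AA'|A'A] := Ctot _ _ CA CA'.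
    by exists A => // x Ax; split=> //; exact: AA'.
  by exists A' => // x Ax; split=> //; exact: A'A.
have PF : ProperFilter (filter_from C id) by exact: filter_from_proper.
have [|x [_ clx]] := cX _ PF; first exact: filterT.
by exists x => A CA; apply: (Ccl A CA) => U nU; apply: clx nU; exists A.
Qed.

(** Zorn's lemma for reverse inclusion: compactness keeps the intersection of a chain nonempty, and
    [P] is assumed to pass to intersections. [P] stays abstract because it serves both for
    invariance under the group and for closure under composition. *)
Lemma exists_minimal_closed (X : topologicalType) (P : set (set X))
    (A0 : set X) :
  compact [set: X] ->
  (forall C : set (set X), C !=set0 -> C `<=` P -> P (\bigcap_(A in C) A)) ->
  closed A0 -> A0 !=set0 -> P A0 ->
  exists A, [/\ A `<=` A0, closed A, A !=set0, P A &
    forall A', A' `<=` A -> closed A' -> A' !=set0 -> P A' -> A' = A].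
Proof.
move=> cX Pcap clA0 nA0 PA0.
pose Q A := [/\ A `<=` A0, closed A, A !=set0 & P A].
have QA0 : Q A0 by split=> //; exact: subset_refl.
pose T := {A | Q A}.
pose r (s t : T) : bool := `[< sval t `<=` sval s >].
have rP s t : r s t <-> sval t `<=` sval s.
  by split=> [/asboolP|?]; last exact/asboolP.
have [||||[A [sA clA nA PA]] minA] := @Zorn T r.
- by move=> t; apply/rP; exact: subset_refl.
- by move=> r1 s t /rP rs /rP st; apply/rP/(subset_trans st).
- by move=> [A QA] [A' QA'] /rP /= AA' /rP /= A'A; apply: eq_exist;
     apply/seteqP.
- move=> C Ctot; have [[A1 CA1]|C0] := pselect (C !=set0); last first.
    by exists (exist _ A0 QA0) => s Cs; case: C0; exists s.
  pose C' := [set sval s | s in C].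
  have C'n0 : C' !=set0 by exists (sval A1), A1.
  have QC' : Q (\bigcap_(A in C') A).
    split.
    + move=> x /(_ (sval A1)) C'x; have [sA1 _ _ _] := svalP A1; apply: sA1.
      by apply: C'x; exists A1.
    + by apply: closed_bigI => A [s Cs <-]; have [] := svalP s.
    + apply: compact_closed_chain => //.
      * move=> _ _ [s Cs <-] [t Ct <-].
        by have [/rP|/rP] := Ctot _ _ Cs Ct; [right|left].
      * by move=> A [s Cs <-]; have [] := svalP s.
      * by move=> A [s Cs <-]; have [] := svalP s.
    + by apply: Pcap => // A [s Cs <-]; have [] := svalP s.
  exists (exist _ _ QC') => s Cs; apply/rP => /= x; apply.
  by exists s.
- exists A; split=> // A' A'A clA' nA' PA'.
  have QA' : Q A' by split=> //; apply: (subset_trans A'A).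
  have /minA/(congr1 sval) : r (exist _ A (And4 sA clA nA PA)) (exist _ A' QA').
    exact/rP.
  by [].
Qed.

Lemma compact_cvg (X : topologicalType) (F : set_system X) (x : X) :
  compact [set: X] -> hausdorff_space X -> ProperFilter F ->
  (forall q, cluster F q -> q = x) -> F --> x.
Proof.
move=> cX hX PF clF; apply: (@compact_cluster_set1 _ x F setT) => //.
- exact: filterT.
- exact: filterT.
- apply/seteqP; split=> [q /clF -> //|_ ->].
  have [|q [_ Fq]] := cX F PF; first exact: filterT.
  by rewrite -(clF q Fq).
Qed.

(** If [q] is a cluster point of [f] at [x], then [(x, q)] lies in the closure of [Z], hence in [Z],
    so [q = f x]; in a compact space a unique cluster point is a limit. *)
Lemma closed_graph_continuous (X Y : topologicalType) (Z : set (X * Y))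
    (f : X -> Y) :
  compact [set: Y] -> hausdorff_space Y -> closed Z ->
  (forall x, Z (x, f x)) -> (forall x y, Z (x, y) -> y = f x) ->
  continuous f.
Proof.
move=> cY hY clZ Zf Zu x; apply: compact_cvg => // q clq; apply: Zu.
apply: clZ => W [[U V] /= [nU nV] UVW].
have [|_ [[x' Ux' <-] Vfx']] := clq (f @` U) V _ nV.
  by apply: filterS nU => x' Ux'; exists x'.
by exists (x', f x'); split=> //; exact: UVW.
Qed.

Lemma compact_set_type (X : topologicalType) (A : set X) :
  compact A -> compact [set: set_type A].
Proof.
move=> cA F PF _; pose G := (@set_val _ A) @ F.
have PG : ProperFilter G by exact: fmap_proper_filter.
have [|x [Ax clx]] := cA G PG.
  suff : F (set_val @^-1` A) by [].
  by apply: (filterS _ filterT) => a _; exact: set_valP. 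
exists (exist _ x (mem_set Ax)); split=> // U V FU.
move=> [_ [[W oW <-] /= Wx] WV].
have [||_ [[a Ua <-] Wa]] := clx ((@set_val _ A) @` U) W.
- by rewrite /G /=; apply: filterS FU => a Ua; exists a.
- exact: open_nbhs_nbhs.
- by exists a; split=> //; exact: WV.
Qed.

Lemma hausdorff_set_type (X : topologicalType) (A : set X) :
  hausdorff_space X -> hausdorff_space (set_type A).
Proof.
move=> hX p q clpq; apply: val_inj; apply: hX => U V nU nV.
have [x [Ux Vx]] := clpq _ _ (@initial_continuous _ _ set_val p U nU)
  (@initial_continuous _ _ set_val q V nV).
by exists (set_val x).
Qed.

Lemma set_val_continuous (X : topologicalType) (A : set X) :
  continuous (@set_val _ A).
Proof. exact: initial_continuous. Qed.

Lemma to_set_type_continuous (X Y : topologicalType) (A : set Y)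
  (f : X -> set_type A) : continuous (fun x => set_val (f x)) -> continuous f.
Proof. by move=> cf; apply: (@continuous_comp_initial _ X _ set_val f cf). Qed.

Lemma closed_preimage (X Y : topologicalType) (f : X -> Y) (A : set Y) :
  continuous f -> closed A -> closed (f @^-1` A).
Proof. by move=> cf; apply: closed_comp => x _; exact: cf. Qed.

Lemma open_preimage (X Y : topologicalType) (f : X -> Y) (A : set Y) :
  continuous f -> open A -> open (f @^-1` A).
Proof. by move=> cf; apply: open_comp => x _; exact: cf. Qed.

Lemma compact_Urysohn (R : realType) (X : topologicalType) (x y : X) :
  compact [set: X] -> hausdorff_space X -> x <> y ->
  exists F : X -> R, [/\ continuous F, forall z, 0 <= F z <= 1, F x = 0 &
    F y = 1].
Proof.
move=> cX hX xy.
have nX := compact_normal hX cX.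
have c1 z : closed [set z : X].
  by apply: compact_closed => //; exact: compact_set1.
have /(uniform_separatorP (R := R)) [F [cF F01 F0 F1]] :
    uniform_separator [set x] [set y].
  apply: ((@normal_separatorP R X).1 nX) => //.
  by apply/seteqP; split=> // z [/= -> ?].
exists F; split=> //.
- move=> z; have := F01 (F z); rewrite /= in_itv /=; apply; by exists z.
- by apply: F0; exists x.
- by apply: F1; exists y.
Qed.

Lemma closed_eqfun (X Y : topologicalType) (f g : X -> Y) :
  hausdorff_space Y -> continuous f -> continuous g ->
  closed [set x | f x = g x].
Proof.
move=> hY cf cg x clx; apply: hY => A C nA nC.
have [|y [/= fgy [Ay Cy]]] := clx (f @^-1` A `&` g @^-1` C).
  by apply: filterI; [exact: cf|exact: cg].
by exists (f y); split=> //; rewrite fgy.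
Qed.

Lemma continuous_pair (X Y Z : topologicalType) (f : X -> Y) (g : X -> Z) :
  continuous f -> continuous g -> continuous (fun x => (f x, g x)).
Proof. by move=> cf cg x; apply: cvg_pair; [exact: cf|exact: cg]. Qed.

Lemma prod_topology_hausdorff (I : Type) (T : I -> topologicalType) :
  (forall i, hausdorff_space (T i)) -> hausdorff_space (prod_topology T).
Proof.
move=> hT p q clpq; apply: functional_extensionality_dep => i; apply: (hT i).
move=> A C nA nC; have [y [Ay Cy]] := clpq _ _
  (@prod_topology_proj_continuous I T i p A nA)
  (@prod_topology_proj_continuous I T i q C nC).
by exists (y i).
Qed.

Lemma prod_topology_compact (I : Type) (T : I -> topologicalType)
    (A : forall i, set (T i)) :
  (forall i, compact (A i)) ->
  compact [set f : prod_topology T | forall i, A i (f i)].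
Proof. exact: (@tychonoff {classic I}). Qed.

Lemma unif_continuous_continuous (U V : uniformType) (f : U -> V) :
  unif_continuous f -> continuous f.
Proof.
move=> uf x A; rewrite -!nbhs_entourageE => -[E entE EA].
exists [set xy | E (f xy.1, f xy.2)]; first exact: uf.
by move=> y /xsectionP /= Exy; apply/EA/xsectionP.
Qed.

Lemma cvg_norm_le (R : realType) (T : Type) (F : set_system T) (f : T -> R)
    (l d : R) : ProperFilter F -> f @ F --> l -> (forall x, `|f x| <= d) ->
  `|l| <= d.
Proof.
move=> PF cf fd; rewrite leNgt; apply/negP => dl.
have cn : `|f x| @[x --> F] --> `|l| by exact: cvg_norm.
have [x /=] := filter_ex (cvgr_gt _ cn _ dl).
by rewrite ltNge fd.
Qed.

End Compactness.

Section ClosedDistance.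
Context {R : realType} {X : topologicalType} {u v : X -> R}.
Hypotheses (cu : continuous u) (cv : continuous v).

Let cuv : continuous (fun x => `|u x - v x|).
Proof.
move=> x.
apply: (@continuous_comp _ _ _ (fun x => u x - v x) (fun r : R => `|r|)).
  by apply: cvgB; [exact: cu|exact: cv].
exact: norm_continuous.
Qed.

Lemma closed_dist_le (d : R) : closed [set x | `|u x - v x| <= d].
Proof. exact: (closed_preimage cuv (@closed_le _ d)). Qed.

Lemma closed_dist_ge (d : R) : closed [set x | d <= `|u x - v x|].
Proof. exact: (closed_preimage cuv (@closed_ge _ d)). Qed.

End ClosedDistance.

(** * Samuel compactifications *)

Section SamuelTheory.
Context {R : realType} {U : uniformType}.
Local Notation Sa := (samuel R U).

Lemma sa_eval_continuous (f : ucfun01 R U) :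
  continuous (fun p : Sa => sval p f).
Proof.
move=> p; apply: (@continuous_comp _ _ _ (fun p : Sa => set_val p)
  (fun q : prod_topology (fun _ : ucfun01 R U => R) => q f)).
  exact: initial_continuous.
exact: prod_topology_proj_continuous.
Qed.

Lemma to_samuel_continuous (X : topologicalType) (h : X -> Sa) :
  (forall f, continuous (fun x => sval (h x) f)) -> continuous h.
Proof.
move=> ch; apply: to_set_type_continuous.
exact: prod_topology_continuous.
Qed.

Lemma samuel_hausdorff : hausdorff_space Sa.
Proof.
by apply/hausdorff_set_type/prod_topology_hausdorff => f; exact: Rhausdorff.
Qed.

Lemma samuel_compact : compact [set: Sa].
Proof.
apply: compact_set_type.
have cT : compact [set f : prod_topology (fun _ : ucfun01 R U => R) |
    forall i, `[0, 1]%classic (f i)].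
  apply: (@prod_topology_compact _ (fun _ => R) (fun _ => `[0, 1]%classic)).
  by move=> _; exact: segment_compact.
apply: (subclosed_compact _ cT); first exact: closed_closure.
have clT := compact_closed
  (prod_topology_hausdorff (fun _ : ucfun01 R U => @Rhausdorff R)) cT.
move=> p clp; apply: clT; move: clp; apply: closureS => _ [x _ <-] f.
by rewrite /= in_itv /=; exact: (svalP f).2.
Qed.

Lemma sa_in_dense (p : Sa) (W : set Sa) : nbhs p W -> exists x, W (sa_in R x).
Proof.
move=> [_ [[V oV <-] /= Vp] VW].
have [q [[x _ <-] Vx]] := set_mem (svalP p) V (open_nbhs_nbhs (conj oV Vp)).
by exists x; exact: VW.
Qed.

(** Density of [U] in its compactification, as an induction principle: closed conditions need only
    be checked on [U]. *)
Lemma sa_closed_ind (P : set Sa) :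
  closed P -> (forall x, P (sa_in R x)) -> forall p, P p.
Proof.
move=> clP Px p; apply: clP => W nW; have [x Wx] := sa_in_dense nW.
by exists (sa_in R x).
Qed.

Lemma sa_eval01 (p : Sa) (f : ucfun01 R U) : 0 <= sval p f <= 1.
Proof.
move: p; apply: sa_closed_ind => [|x]; last exact: (svalP f).2.
have -> : (fun p : Sa => is_true (0 <= sval p f <= 1)) =
    (fun p : Sa => sval p f) @^-1` `[0, 1]%classic.
  by apply/funext => p /=; rewrite in_itv.
apply: closed_preimage; first exact: sa_eval_continuous.
exact: itv_closed.
Qed.

#[global] Instance sa_nbhs_proper (p : Sa) : ProperFilter (sa_nbhs p).
Proof.
apply: filter_from_proper; last by move=> W /sa_in_dense [x Wx]; exists x.
apply: filter_from_filter; first by exists setT; exact: filterT.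
by move=> V W nV nW; exists (V `&` W) => //; exact: filterI.
Qed.

Lemma sa_nbhs_cvg (p : Sa) : sa_in R x @[x --> sa_nbhs p] --> p.
Proof. by move=> W nW; exists W. Qed.

Lemma sa_eval_cvg (p : Sa) (f : ucfun01 R U) :
  sval f x @[x --> sa_nbhs p] --> sval p f.
Proof.
apply: (@cvg_comp _ _ _ (@sa_in R U) (fun q : Sa => sval q f) _ _ _
  (@sa_nbhs_cvg p)).
exact: sa_eval_continuous.
Qed.

End SamuelTheory.

(** * Flows *)

Section FlowTheory.
Context {G : topologicalGroupType}.
Implicit Types X Y : topologicalType.

Definition invariant_set X (act : G -> X -> X) (A : set X) : Prop :=
  forall g x, A x -> A (act g x).

Definition minimal_set X (act : G -> X -> X) (Z : set X) : Prop :=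
  [/\ closed Z, Z !=set0, invariant_set act Z &
    forall A, A `<=` Z -> closed A -> A !=set0 -> invariant_set act A -> A = Z].

Section OneFlow.
Context {X : topologicalType} {act : G -> X -> X}.
Hypothesis flX : is_flow act.

Lemma flow_act_continuous g : continuous (act g).
Proof.
move=> x; apply: (@continuous_comp _ _ _ (fun x => (g, x))
  (fun gx : G * X => act gx.1 gx.2)); last exact: (flow_continuous flX).
by apply: cvg_pair; [exact: cvg_cst|exact: cvg_id].
Qed.

Lemma orbit_closure_invariant x : invariant_set act (closure (range (act^~ x))).
Proof.
move=> g y cly A nA.
have [_ [[h _ <-] Ah]] := cly _ (@flow_act_continuous g y A nA).
by exists (act (g * h)%g x); split; [exists (g * h)%g|rewrite (flow_actM flX)].
Qed.

Lemma orbit_closure_sub (A : set X) x : closed A -> invariant_set act A ->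
  A x -> closure (range (act^~ x)) `<=` A.
Proof.
move=> clA iA Ax y cly; apply: clA; move: y cly; apply: closureS => _ [g _ <-].
exact: iA.
Qed.

Lemma orbit_closure_self x : closure (range (act^~ x)) x.
Proof. by apply: subset_closure; exists 1%g; rewrite // (flow_act1 flX). Qed.

Lemma exists_minimal_set (A : set X) : closed A -> A !=set0 ->
  invariant_set act A -> exists2 Z, Z `<=` A & minimal_set act Z.
Proof.
move=> clA nA iA.
have [|Z [ZA clZ nZ iZ minZ]] := exists_minimal_closed (P := invariant_set act)
  (flow_compact flX) _ clA nA iA; last by exists Z.
by move=> C _ Ci g x Cx B CB; apply: Ci => //; exact: Cx.
Qed.

Lemma minimal_set_orbit (Z : set X) z : minimal_set act Z -> Z z ->
  Z `<=` closure (range (act^~ z)).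
Proof.
move=> [clZ nZ iZ minZ] Zz; rewrite -{1}(minZ (closure (range (act^~ z)))) //.
- exact: orbit_closure_sub.
- exact: closed_closure.
- by exists z; exact: orbit_closure_self.
- exact: orbit_closure_invariant.
Qed.

Lemma minimal_set_orbit_meets (Z W : set X) z w : minimal_set act Z ->
  Z z -> Z w -> nbhs w W -> exists g, W (act g z).
Proof.
move=> mZ Zz Zw nW; have [_ [[g _ <-] Wg]] := minimal_set_orbit mZ Zz Zw nW.
by exists g.
Qed.

(** Every point of [Z] is moved into [W] by some [g], and the same [g] works nearby; compactness of
    [Z] leaves finitely many. *)
Lemma minimal_set_finite_cover (Z W : set X) w : minimal_set act Z ->
  Z w -> open W -> W w ->
  exists S : {fset G}, forall z, Z z -> exists2 g, g \in S & W (act g z).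
Proof.
move=> mZ Zw oW Ww; have [clZ _ _ _] := mZ.
(* Finite subsets of [G] directed by inclusion: the near-covering form of compactness along this
   filter produces one [S] for all of [Z]. *)
pose F : set_system {fset G} :=
  filter_from setT (fun S0 => [set S : {fset G} | (S0 `<=` S)%fset]).
have FF : ProperFilter F.
  apply: filter_from_proper; last first.
    by move=> S0 _; exists S0; exact: fsubset_refl.
  apply: filter_from_filter; first by exists fset0.
  move=> S1 S2 _ _; exists (S1 `|` S2)%fset => // S.
  by move=> /= /[dup] /(fsubset_trans (fsubsetUl _ _)) ? 
    /(fsubset_trans (fsubsetUr _ _)).
have cZ : compact Z.
  exact: (subclosed_compact clZ (flow_compact flX) (@subsetT _ _)).
have /near_covering_withinP nc := (compact_near_coveringP Z).1 cZ.
have [z Zz|S0 _ S0P] := nc _ F (fun S z => exists2 g, g \in S & W (act g z)) _.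
  have [g Wgz] :=
    minimal_set_orbit_meets mZ Zz Zw (open_nbhs_nbhs (conj oW Ww)).
  exists (act g @^-1` W, [set S : {fset G} | g \in S]).
    split=> /=.
      by apply: flow_act_continuous; exact: open_nbhs_nbhs.
    by exists [fset g]%fset => // S /=; rewrite fsub1set.
  by move=> [z' S] /= [Wgz' gS] _; exists g.
by exists S0 => z; apply: S0P; exact: fsubset_refl.
Qed.

Lemma subflow (A : set X) (iA : invariant_set act A) :
  closed A -> A !=set0 ->
  is_flow (fun g (x : set_type A) =>
    exist _ (act g (sval x)) (mem_set (iA g _ (set_mem (svalP x))))
      : set_type A).
Proof.
move=> clA [a Aa]; split.
- by exists (exist _ a (mem_set Aa)).
- apply: compact_set_type.
  exact: (subclosed_compact clA (flow_compact flX) (@subsetT _ _)).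
- by apply: hausdorff_set_type; exact: flow_hausdorff flX.
- by move=> x; apply: val_inj; exact: flow_act1.
- by move=> g h x; apply: val_inj; exact: flow_actM.
- apply: to_set_type_continuous => -[g x].
  apply: (@continuous_comp _ _ _
    (fun gx : G * set_type A => (gx.1, set_val gx.2))
    (fun gx : G * X => act gx.1 gx.2)); last exact: (flow_continuous flX).
  apply: cvg_pair; first exact: cvg_fst.
  apply: (@continuous_comp _ _ _ (@snd G (set_type A)) (@set_val _ A)).
    exact: cvg_snd.
  exact: set_val_continuous.
Qed.

Lemma minimal_subflow (Z : set X) (iZ : invariant_set act Z) :
  minimal_set act Z ->
  minimal_flow (fun g (x : set_type Z) =>
    exist _ (act g (sval x)) (mem_set (iZ g _ (set_mem (svalP x))))
      : set_type Z).
Proof.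
move=> mZ; have [clZ nZ _ _] := mZ; split; first exact: subflow.
move=> x W [y Wy]; rewrite openE => /(_ _ Wy) [_ [[V oV <-] /= Vy] VW].
have [g Vg] := minimal_set_orbit_meets mZ (set_mem (svalP x))
  (set_mem (svalP y)) (open_nbhs_nbhs (conj oV Vy)).
exists (exist _ (act g (sval x)) (mem_set (iZ g _ (set_mem (svalP x))))).
by split; [exact: VW|exists g].
Qed.

(** The orbit closure of [id] in this flow is the enveloping semigroup of [X]. *)
Lemma powerflow : is_flow (fun g (e : prod_topology (fun _ : X => X)) =>
  (fun t => act g (e t)) : prod_topology (fun _ : X => X)).
Proof.
split.
- by exists id.
- have := @prod_topology_compact X (fun _ => X) (fun _ => setT)
    (fun _ => flow_compact flX).
  by congr (compact _); apply/seteqP; split.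
- by apply: prod_topology_hausdorff => _; exact: flow_hausdorff flX.
- by move=> e; apply/funext => t; exact: flow_act1.
- by move=> g h e; apply/funext => t; exact: flow_actM.
- apply: prod_topology_continuous => t -[g e].
  apply: (@continuous_comp _ _ _
    (fun ge : G * prod_topology (fun _ : X => X) => (ge.1, ge.2 t))
    (fun gx : G * X => act gx.1 gx.2)); last exact: (flow_continuous flX).
  apply: cvg_pair; first exact: cvg_fst.
  apply: (@continuous_comp _ _ _ snd
    (fun e : prod_topology (fun _ : X => X) => e t)); first exact: cvg_snd.
  exact: prod_topology_proj_continuous.
Qed.

(** For each [x] the bound holds near [(x, 1)] by joint continuity; compactness of [X] makes the
    neighbourhood of the identity independent of [x]. *)
Lemma flow_equicontinuous (R : realType) (F : X -> R) (d : R) :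
  continuous F -> 0 < d ->
  \forall u \near (1%g : G), forall x, `|F (act u x) - F x| < d.
Proof.
move=> cF d0.
have nc := (compact_near_coveringP [set: X]).1 (flow_compact flX).
suff nU : \forall u \near (1%g : G),
    [set: X] `<=` (fun x => `|F (act u x) - F x| < d).
  by apply: filterS nU => u uP x; exact: uP.
apply: nc => x _.
have cH : continuous (fun xu : X * G => F (act xu.2 xu.1) - F xu.1).
  move=> xu; apply: (@continuousB _ _ _ (fun xu : X * G => F (act xu.2 xu.1))
    (fun xu => F xu.1)).
    apply: (@continuous_comp _ _ _ (fun xu : X * G => act xu.2 xu.1) F).
      apply: (@continuous_comp _ _ _ (fun xu : X * G => (xu.2, xu.1))
        (fun gx : G * X => act gx.1 gx.2)); last exact: (flow_continuous flX).
      by apply: cvg_pair; [exact: cvg_snd|exact: cvg_fst].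
    exact: cF.
  apply: (@continuous_comp _ _ _ (@fst X G) F); first exact: cvg_fst.
  exact: cF.
have cu := cH (x, 1%g).
rewrite /continuous_at /= (flow_act1 flX) subrr in cu.
have nH := cvgr_dist_lt _ _ cu _ d0.
suff : nbhs (x, 1%g : G) [set xu : X * G | `|F (act xu.2 xu.1) - F xu.1| < d].
  by [].
apply: filterS (nH _) => xu.
by rewrite /= sub0r normrN.
Qed.

End OneFlow.
End FlowTheory.

(** * Products, equivariant maps and sections over a universal flow *)

Section FlowMaps.
Context {G : topologicalGroupType}.

Lemma prodflow (X Y : topologicalType) (actX : G -> X -> X)
    (actY : G -> Y -> Y) : is_flow actX -> is_flow actY ->
  is_flow (fun g (xy : X * Y) => (actX g xy.1, actY g xy.2)).
Proof.
move=> flX flY; split.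
- have [[x _] [y _]] := (flow_nonempty flX, flow_nonempty flY).
  by exists (x, y).
- rewrite -setXTT; apply: compact_setX.
    exact: (flow_compact flX).
  exact: (flow_compact flY).
- move=> [x y] [x' y'] cl; congr pair.
    apply: (flow_hausdorff flX) => A C nA nC.
    have [||[u v] [Au Cu]] := cl (fst @^-1` A) (fst @^-1` C).
    + exact: (@cvg_fst _ _ (nbhs x) (nbhs y)).
    + exact: (@cvg_fst _ _ (nbhs x') (nbhs y')).
    + by exists u.
  apply: (flow_hausdorff flY) => A C nA nC.
  have [||[u v] [Av Cv]] := cl (snd @^-1` A) (snd @^-1` C).
  + exact: (@cvg_snd _ _ (nbhs x) (nbhs y)).
  + exact: (@cvg_snd _ _ (nbhs x') (nbhs y')).
  + by exists v.
- by move=> [x y] /=; rewrite (flow_act1 flX) (flow_act1 flY).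
- by move=> g h [x y] /=; rewrite (flow_actM flX) (flow_actM flY).
- have c1 : continuous (fun gx : G * (X * Y) => actX gx.1 gx.2.1).
    move=> gx.
    apply: (@continuous_comp _ _ _ (fun gx : G * (X * Y) => (gx.1, gx.2.1))
      (fun gx : G * X => actX gx.1 gx.2)); last exact: (flow_continuous flX).
    apply: cvg_pair; first exact: cvg_fst.
    apply: (@continuous_comp _ _ _ (@snd G (X * Y)) (@fst X Y)).
      exact: cvg_snd.
    exact: cvg_fst.
  have c2 : continuous (fun gx : G * (X * Y) => actY gx.1 gx.2.2).
    move=> gx.
    apply: (@continuous_comp _ _ _ (fun gx : G * (X * Y) => (gx.1, gx.2.2))
      (fun gx : G * Y => actY gx.1 gx.2)); last exact: (flow_continuous flY).
    apply: cvg_pair; first exact: cvg_fst.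
    apply: (@continuous_comp _ _ _ (@snd G (X * Y)) (@snd X Y)).
      exact: cvg_snd.
    exact: cvg_snd.
  by move=> gx; apply: cvg_pair; [exact: c1|exact: c2].
Qed.

Section Minimal.
Context {M : topologicalType} {actM : G -> M -> M}.
Hypothesis mM : minimal_flow actM.

Lemma minimal_flow_closed (A : set M) :
  closed A -> A !=set0 -> invariant_set actM A -> A = setT.
Proof.
move=> clA [x Ax] iA; apply/seteqP; split=> // y _; apply: clA => W.
rewrite nbhsE => -[V [oV Vy] VW].
have [z [Vz [g _ gz]]] := mM.2 x V (ex_intro _ y Vy) oV.
by exists z; split; [rewrite -gz; exact: iA|exact: VW].
Qed.

Lemma equivariant_surj (X : topologicalType) (actX : G -> X -> X)
    (f : X -> M) : is_flow actX -> continuous f -> equivariant actX actM f ->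
  forall m, exists x, f x = m.
Proof.
move=> flX cf ef m; have := minimal_flow_closed (A := range f).
move=> /(_ _ _ _)/seteqP/= [||g _ [x _ <-]|_ /(_ m I) [x _ <-]].
- apply: compact_closed; first exact: (flow_hausdorff mM.1).
  apply: continuous_compact; last exact: (flow_compact flX).
  exact: continuous_subspaceT.
- by have [x _] := flow_nonempty flX; exists (f x), x.
- by exists (actX g x).
- by exists x.
Qed.

Lemma equivariant_eq (X : topologicalType) (actX : G -> X -> X)
    (f h : M -> X) m0 : hausdorff_space X -> continuous f -> continuous h ->
  equivariant actM actX f -> equivariant actM actX h -> f m0 = h m0 -> f =1 h.
Proof.
move=> hX cf ch ef eh fh m.
have /seteqP[_ /(_ m I)] // : [set m | f m = h m] = setT.
apply: minimal_flow_closed.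
- exact: closed_eqfun.
- by exists m0.
- by move=> g x /= fhx; rewrite ef eh fhx.
Qed.

End Minimal.

(* Ellis' lemma, in the enveloping semigroup of [X]. *)
Lemma exists_idempotent (X : topologicalType) (act : G -> X -> X) :
  is_flow act ->
  let actE g (e : prod_topology (fun _ : X => X)) :=
    (fun t => act g (e t)) : prod_topology (fun _ : X => X) in
  exists Z : set (prod_topology (fun _ : X => X)), exists u,
    [/\ Z `<=` closure (range (actE^~ id)), minimal_set actE Z, Z u &
      forall x, u (u x) = u x].
Proof.
move=> flX actE; set E := prod_topology (fun _ : X => X).
have flE : is_flow actE by exact: powerflow.
have hE : hausdorff_space E by exact: (flow_hausdorff flE).
have [Z ZS mZ] : exists2 Z, Z `<=` closure (range (actE^~ id)) &
    minimal_set actE Z.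
  apply: (exists_minimal_set flE); first exact: closed_closure.
    by exists id; exact: orbit_closure_self.
  exact: orbit_closure_invariant.
have [clZ nZ iZ _] := mZ.
(* Composition is continuous in its left factor for the product topology; it need not be in the
   right one, so only [p |-> p \o q] is used below. *)
have cr (q : E) : continuous ((fun p => p \o q) : E -> E).
  apply: prod_topology_continuous => t.
  exact: (@prod_topology_proj_continuous X (fun _ => X) (q t)).
pose sg (A : set E) := forall p q : E, A p -> A q -> A (p \o q).
(* For [q] in [Z], the [p] with [p \o q] in [Z] form a closed invariant set containing [id], hence
   containing the enveloping semigroup and in particular [Z]. *)
have sgZ : sg Z.
  move=> p q Zp Zq; have := ZS p Zp; move: p {Zp}.
  apply: (@orbit_closure_sub _ _ actE [set p : E | Z (p \o q)]).
  - by apply: (@closed_preimage E E _ _ (cr q)).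
  - by move=> g p /= Zpq; exact: (iZ g _ Zpq).
  - exact: Zq.
have [|A [AZ clA [t At] sgA minA]] := exists_minimal_closed (P := sg)
    (flow_compact flE) _ clZ nZ sgZ.
  by move=> C _ Csg p q Cp Cq D CD; apply: (Csg _ CD); [exact: Cp|exact: Cq].
(* Minimality of the closed subsemigroup [A] is used twice: [A \o t] is a closed subsemigroup of
   [A], so [t = u \o t] for some [u]; then the [p] in [A] fixing [t] from the left form another one,
   so [t] itself fixes [t]. *)
have At_eq : (fun p : E => (p \o t) : E) @` A = A.
  apply: minA.
  - by move=> _ [p Ap <-]; exact: sgA.
  - apply: (compact_closed hE); apply: continuous_compact.
      by apply: continuous_subspaceT; exact: cr.
    exact: (subclosed_compact clA (flow_compact flE) (@subsetT _ _)).
  - by exists (t \o t : E), t.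
  - move=> _ _ [p Ap <-] [q Aq <-]; exists ((p \o t) \o q : E) => //.
    exact: (sgA (p \o t) q (sgA p t Ap At) Aq).
have [u Au ut] : ((fun p : E => (p \o t) : E) @` A) t by rewrite At_eq.
have /seteqP [_ /(_ t At) [_ tt]] : A `&` [set p : E | (p \o t : E) = t] = A.
  apply: minA.
  - by move=> p [].
  - apply: closedI => //.
    apply: (@closed_eqfun E E (fun p => p \o t : E) (fun _ => t) hE (cr t)).
    exact: cst_continuous.
  - by exists u.
  - move=> p q [Ap pt] [Aq qt]; split; first exact: sgA.
    by rewrite /= -[RHS]pt -[in RHS]qt.
exists Z, t; split=> //; first exact: AZ.
by move=> x; exact: (congr1 (@^~ x) tt).
Qed.

(* If [u] is an idempotent of a minimal subset [Z] of the enveloping semigroup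
   of [X] and [al : M -> Z] comes from universality, choose [x0] with
   [al (q x0) = u]; then evaluation of [al] at [u x0] is a section. *)
Lemma universal_section (M X : topologicalType) (actM : G -> M -> M)
    (actX : G -> X -> X) (q : X -> M) :
  universal_minimal_flow actM -> is_flow actX -> continuous q ->
  equivariant actX actM q ->
  exists s : M -> X, [/\ continuous s, equivariant actM actX s & cancel s q].
Proof.
move=> [mM uM] flX cq eq.
have hM : hausdorff_space M by exact: (flow_hausdorff mM.1).
have [Z [u [ZS mZ Zu uu]]] := exists_idempotent flX.
have [_ _ iZ _] := mZ.
have flE := powerflow flX.
have mF := minimal_subflow flE iZ mZ.
have [al [cal eal sal]] := uM _ _ mF.
pose E := prod_topology (fun _ : X => X).
pose al' m : E := set_val (al m).
have cal' : continuous al'.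
  move=> m; apply: (@continuous_comp _ _ _ al (@set_val _ Z)); first exact: cal.
  exact: set_val_continuous.
have eal' g m x : al' (actM g m) x = actX g (al' m x).
  by rewrite /al' eal.
have [w0 _ alw0] := sal (exist _ u (mem_set Zu)) I.
have {}alw0 : al' w0 = u by rewrite /al' alw0.
have [x0 qx0] := equivariant_surj mM flX cq eq w0.
have ev (x : X) : continuous (fun p : E => p x).
  exact: prod_topology_proj_continuous.
(* The relation [al' (q (p x0)) = p \o u] holds at [p = id] by the choice of [x0], is closed in [p]
   and invariant, so it holds on the enveloping semigroup. At [p = u] idempotency gives the
   claim. *)
have key : al' (q (u x0)) = u.
  have : [set p : E | al' (q (p x0)) = (p \o u : E)] u.
    apply: (@orbit_closure_sub _ E (fun g e t => actX g (e t))
      [set p : E | al' (q (p x0)) = (p \o u : E)] id _ _ _ u (ZS u Zu)).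
    - apply: closed_eqfun.
      + exact: (flow_hausdorff flE).
      + move=> p; apply: (@continuous_comp _ _ _ (fun p : E => q (p x0)) al').
          apply: (@continuous_comp _ _ _ (fun p : E => p x0) q).
            exact: ev.
          exact: cq.
        exact: cal'.
      + by apply: prod_topology_continuous => t; exact: ev.
    - move=> g p /= IH; apply/funext => x.
      by rewrite /= eq eal' IH.
    - by rewrite /= qx0 alw0.
  by move=> /= ->; apply/funext => x /=; exact: uu.
exists (fun m => al' m (u x0)).
have cs : continuous (fun m => al' m (u x0)).
  move=> m; apply: (@continuous_comp _ _ _ al' (fun p : E => p (u x0))).
    exact: cal'.
  exact: ev.
have es : equivariant actM actX (fun m => al' m (u x0)).
  by move=> g m; exact: eal'.
(* The maps [q \o s] and [id] are equivariant and agree at [q (u x0)], because there the section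
   takes the value [u (u x0) = u x0]. *)
split=> // m; apply: (@equivariant_eq _ _ mM _ actM
  (fun m => q (al' m (u x0))) id (q (u x0))) => //.
- move=> m'; apply: (@continuous_comp _ _ _ (fun m => al' m (u x0)) q).
    exact: cs.
  exact: cq.
- by move=> m'; exact: cvg_id.
- by move=> g m'; rewrite /= eal' eq.
- by rewrite /= key uu.
Qed.

End FlowMaps.

(** * Limits along points of Sa(G) *)

Section SamuelFlow.
Context {R : realType} {G : topologicalGroupType}.

Lemma right_unif_continuousP (f : G -> R) :
  (forall d, 0 < d -> exists2 U, nbhs (1%g : G) U &
    forall g h, U (g * h^-1)%g -> `|f g - f h| < d) ->
  unif_continuous (f : right_uniform G -> R).
Proof.
move=> uf A; rewrite /= nbhs_simpl -entourage_ballE => -[d d0 dA].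
have [U nU UP] := uf d d0.
by exists U => // -[g h] /= /UP gh; apply: dA.
Qed.

Lemma flow_ucfun (X : topologicalType) (act : G -> X -> X) (F : X -> R) x :
  is_flow act -> continuous F ->
  unif_continuous ((fun g => F (act g x)) : right_uniform G -> R).
Proof.
move=> flX cF; apply: right_unif_continuousP => d d0.
have nU := flow_equicontinuous flX cF d0.
exists [set u | forall x, `|F (act u x) - F x| < d] => // g h /=.
by move=> /(_ (act h x)); rewrite -(flow_actM flX) mulgVK.
Qed.

(** For continuous [F : X -> [0, 1]] the function [g |-> F (g x)] is right uniformly continuous, so
    it converges along [p] to a coordinate of [p]. All cluster points of [g x] therefore agree on
    every [F], and Urysohn functions separate points. *)
Lemma sa_act_cvg (X : topologicalType) (act : G -> X -> X)
    (p : samuel R (right_uniform G)) x :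
  is_flow act -> act g x @[g --> sa_nbhs p] --> sa_act act p x.
Proof.
move=> flX; suff [z cz] : exists z : X, act g x @[g --> sa_nbhs p] --> z.
  exact: (@xgetPex X x (fun z => act g x @[g --> sa_nbhs p] --> z)
    (ex_intro _ z cz)).
have [cX hX] := (flow_compact flX, flow_hausdorff flX).
pose K : set_system X := act g x @[g --> sa_nbhs p].
have PK : ProperFilter K.
  exact: (fmap_proper_filter (act^~ x) (sa_nbhs_proper p)).
have [|z [_ Kz]] := cX K PK; first exact: filterT.
exists z; apply: compact_cvg => // q Kq; apply: contrapT => qz.
have [F [cF F01 Fq Fz]] := compact_Urysohn R cX hX qz.
pose f : ucfun01 R (right_uniform G) :=
  exist _ (fun g => F (act g x)) (conj (flow_ucfun x flX cF) (fun g => F01 _)).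
have cf : F y @[y --> K] --> sval p f := sa_eval_cvg (p := p) (f := f).
have clF y : cluster K y -> F y = sval p f.
  move=> Ky; apply: (@Rhausdorff R) => A C nA nC.
  have [y' [Cy' Ay']] := Ky _ _ (cf C nC) (cF y A nA).
  by exists (F y').
by have := clF q Kq; rewrite -(clF z Kz) Fq Fz => /esym/eqP; rewrite oner_eq0.
Qed.

End SamuelFlow.

Section SamuelMaps.
Context {R : realType}.

Lemma sa_map_id (U : uniformType) (phi : U -> U) (uphi : unif_continuous phi) :
  phi =1 id -> forall p : samuel R U, sa_map uphi p = p.
Proof.
move=> phiE p; apply: val_inj; apply/funext => -[f pf] /=; congr (sval p _).
by apply: eq_exist => /=; apply/funext => x /=; rewrite phiE.
Qed.

Lemma sa_map_comp (U V W : uniformType) (phi : V -> W) (psi : U -> V)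
    (chi : U -> W) (uphi : unif_continuous phi) (upsi : unif_continuous psi)
    (uchi : unif_continuous chi) :
  (forall x, phi (psi x) = chi x) ->
  forall p : samuel R U, sa_map uphi (sa_map upsi p) = sa_map uchi p.
Proof.
move=> chiE p; apply: val_inj; apply/funext => f /=; congr (sval p _).
by apply: eq_exist => /=; apply/funext => x /=; rewrite chiE.
Qed.

Lemma sa_eval_dist (U : uniformType) (f g : ucfun01 R U) (d : R) :
  (forall x, `|sval f x - sval g x| <= d) ->
  forall p : samuel R U, `|sval p f - sval p g| <= d.
Proof.
move=> fg; apply: sa_closed_ind => [|x]; last exact: fg.
apply: (@closed_preimage _ R (fun p : samuel R U => `|sval p f - sval p g|)
  [set r | r <= d]); last exact: closed_le.
move=> p; apply: (@continuous_comp _ _ _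
  (fun p : samuel R U => sval p f - sval p g) (fun r : R => `|r|)).
  by apply: (@continuousB _ R^o); exact: sa_eval_continuous.
exact: norm_continuous.
Qed.

End SamuelMaps.

(** * The folded flow *)

Section FoldedTheory.
Context {R : realType} {G : topologicalGroupType} {disp : Order.disp_t}
  {B : joinSemilatticeType disp} {a : join_action G B}
  {theta : seminorm_map R a} (Om : skeleton theta).
Local Notation Y := (folded Om).
Local Notation Sa s := (samuel R (Om s)).

Lemma skel_pi_id (s : B) (ss : (s <= s)%O) (x : Om s) : skel_pi ss x = x.
Proof.
have [y _ <-] := skel_pi_surj ss (I : [set: Om s] x).
by rewrite (skel_pi_comp ss ss ss).
Qed.

Lemma skel_act_lip (s t : B) (g : G) (sgt : (a s g <= t)%O) (x y : Om t) :
  (edist (skel_act sgt x, skel_act sgt y) <= edist (x, y))%E.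
Proof. by rewrite /skel_act skel_lam_isom skel_pi_lip. Qed.

Lemma skel_act_unif (s t : B) (g : G) (sgt : (a s g <= t)%O) :
  unif_continuous (skel_act sgt : Om t -> Om s).
Proof. exact/edist_lip_unif_continuous/skel_act_lip. Qed.

Lemma folded_proj_pi (s t : B) (st : (s <= t)%O) (y : Y) :
  sa_map (skel_pi_unif st) (folded_proj t y) = folded_proj s y.
Proof. exact: (set_mem (svalP y) _ _ st). Qed.

Lemma folded_proj_act (s t : B) (g : G) (sgt : (a s g <= t)%O) (y : Y) :
  folded_proj s (folded_act Om g y) =
  sa_map (skel_act_unif sgt) (folded_proj t y).
Proof.
rewrite /folded_proj /= -/(folded_proj _ y) -(folded_proj_pi sgt).
exact: sa_map_comp.
Qed.

Lemma folded_proj_pi_in (s t : B) (st : (s <= t)%O) (y : Y) (x : Om t) :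
  folded_proj t y = sa_in R x -> folded_proj s y = sa_in R (skel_pi st x).
Proof. by move=> yx; rewrite -(folded_proj_pi st) yx sa_map_in. Qed.

Lemma folded_proj_act_in (s t : B) (g : G) (sgt : (a s g <= t)%O) (y : Y)
    (x : Om t) : folded_proj t y = sa_in R x ->
  folded_proj s (folded_act Om g y) = sa_in R (skel_act sgt x).
Proof. by move=> yx; rewrite (folded_proj_act sgt) yx sa_map_in. Qed.

Lemma folded_proj_continuous (s : B) :
  continuous (@folded_proj _ _ _ _ _ _ Om s).
Proof.
move=> y; apply: (@continuous_comp _ _ _ (fun y : Y => set_val y)
  (fun z : prod_topology (fun s : B => Sa s) => z s)).
  exact: initial_continuous.
exact: prod_topology_proj_continuous.
Qed.

Lemma to_folded_continuous (X : topologicalType) (h : X -> Y) :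
  (forall s, continuous (fun x => folded_proj s (h x))) -> continuous h.
Proof.
move=> ch; apply: to_set_type_continuous; exact: prod_topology_continuous.
Qed.

Lemma samuel_product_compact : compact [set: prod_topology (fun s : B => Sa s)].
Proof.
have := @prod_topology_compact B (fun s => Sa s) (fun _ => setT)
  (fun s => @samuel_compact R (Om s)).
by congr (compact _); apply/seteqP; split.
Qed.

Lemma folded_compact : compact [set: Y].
Proof.
apply: compact_set_type.
apply: (subclosed_compact _ samuel_product_compact (@subsetT _ _)).
have -> : @folded_set _ _ _ _ _ _ Om =
    \bigcap_(stp in [set: {st : B * B | (st.1 <= st.2)%O}])
    [set y : prod_topology (fun s : B => Sa s) |
      sa_map (skel_pi_unif (proj2_sig stp)) (y (sval stp).2) = y (sval stp).1].
  apply/seteqP; split=> [y Ey [[s t] /= st] _|y Ey s t st] /=; first exact: Ey.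
  exact: (Ey (exist _ (s, t) st) I).
apply: closed_bigI => -[[s t] /= st] _; apply: closed_eqfun.
- exact: samuel_hausdorff.
- move=> y; apply: (@continuous_comp _ _ _
    (fun y : prod_topology (fun s : B => Sa s) => y t)).
    exact: prod_topology_proj_continuous.
  exact: sa_map_continuous.
- exact: prod_topology_proj_continuous.
Qed.

Lemma folded_hausdorff : hausdorff_space Y.
Proof.
apply/hausdorff_set_type/prod_topology_hausdorff => s.
exact: samuel_hausdorff.
Qed.

Lemma folded_eq (y y' : Y) :
  (forall s, folded_proj s y = folded_proj s y') -> y = y'.
Proof.
by move=> yy'; apply: val_inj; apply: functional_extensionality_dep.
Qed.

(** Compactness over the directed set [B]: [C t] holds the families that take the value [x] at [s]
    and are compatible below [t]. These closed sets decrease with [t], and a cluster point of them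
    is a point of the inverse limit. *)
Lemma folded_lift (s : B) (x : Om s) :
  exists y : Y, folded_proj s y = sa_in R x.
Proof.
pose P := prod_topology (fun s : B => Sa s).
pose C t := [set z : P | z s = sa_in R x /\
  forall u (ut : (u <= t)%O), sa_map (skel_pi_unif ut) (z t) = z u].
have Cn0 t : (s <= t)%O -> C t !=set0.
  move=> st; have [xt _ xtx] := skel_pi_surj st (I : [set: Om s] x).
  (* Below [t] the coordinates are the images of a preimage [xt] of [x]; elsewhere they are
     arbitrary. *)
  have ex u : exists p : Sa u, forall ut : (u <= t)%O,
      p = sa_in R (skel_pi ut xt).
    have [ut|ut] := pselect (u <= t)%O.
      exists (sa_in R (skel_pi ut xt)) => ut'.
      by rewrite (bool_irrelevance ut ut').
    by have [x0 _] := skel_nonempty Om u; exists (sa_in R x0).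
  exists (fun u => projT1 (cid (ex u))); split.
    by rewrite (projT2 (cid (ex s)) st) xtx.
  move=> u ut; rewrite (projT2 (cid (ex u)) ut).
  by rewrite (projT2 (cid (ex t)) (lexx t)) sa_map_in skel_pi_id.
have Cle t t' : (t <= t')%O -> C t' `<=` C t.
  move=> tt' z [zs zt]; split=> // u ut.
  rewrite -(zt _ tt') -(zt _ (le_trans ut tt')); apply: sa_map_comp => y.
  exact: skel_pi_comp.
have clC t : closed (C t).
  have -> : C t = [set z : P | z s = sa_in R x] `&`
     \bigcap_(up in [set: {u : B | (u <= t)%O}])
        [set z : P | sa_map (skel_pi_unif (proj2_sig up)) (z t) = z (sval up)].
    apply/seteqP; split=> [z [zs zt]|z [zs zt]].
      by split=> // -[u ut] _ /=; exact: zt.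
    by split=> // u ut; exact: (zt (exist _ u ut) I).
  apply: closedI.
    apply: closed_eqfun; first exact: samuel_hausdorff.
      exact: prod_topology_proj_continuous.
    exact: cst_continuous.
  apply: closed_bigI => -[u /= ut] _; apply: closed_eqfun.
  - exact: samuel_hausdorff.
  - move=> y; apply: (@continuous_comp _ _ _ (fun y : P => y t)).
      exact: prod_topology_proj_continuous.
    exact: sa_map_continuous.
  - exact: prod_topology_proj_continuous.
pose F : set_system P := filter_from [set t | (s <= t)%O] C.
have PF : ProperFilter F.
  apply: filter_from_proper; last exact: Cn0.
  apply: filter_from_filter; first by exists s => /=.
  move=> t t' /= st st'; exists (t `|` t')%O; first by rewrite /= lexU2 ?st.
  by move=> z Cz; split; apply: Cle Cz; rewrite ?leUl ?leUr.
have [|z [_ Fz]] := samuel_product_compact PF; first exact: filterT.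
have Cz t : (s <= t)%O -> C t z.
  by move=> st; apply: clC => W nW; apply: Fz nW; exists t.
have zY : z \in @folded_set _ _ _ _ _ _ Om.
  rewrite inE => t t' tt'; have [_ Cz'] := Cz _ (leUl s t').
  rewrite -(Cz' _ (leUr t' s)) -(Cz' _ (le_trans tt' (leUr t' s))).
  by apply: sa_map_comp => y; exact: skel_pi_comp.
by exists (exist _ z zY); have [] := Cz s (lexx s).
Qed.

(** Since [B] is directed, finitely many coordinate conditions merge into one at a common upper
    bound, which may be taken above [s]. The filter [N] generated by single-coordinate conditions
    thus converges to [y] in the product. *)
Lemma folded_nbhs (y : Y) (O : set Y) (s : B) : nbhs y O ->
  exists t, (s <= t)%O /\ exists2 W, nbhs (folded_proj t y) W &
    forall y', W (folded_proj t y') -> O y'.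
Proof.
move=> [_ [[V oV <-] /= Vy] VO].
pose P := prod_topology (fun s : B => Sa s).
pose N : set_system P := filter_from
  [set tW : {t : B & set (Sa t)} |
     (s <= tag tW)%O /\ nbhs (folded_proj (tag tW) y) (tagged tW)]
  (fun tW =>
    (fun y' : Y => set_val y') @` (folded_proj (tag tW) @^-1` tagged tW)).
have FN : Filter N.
  apply: filter_from_filter.
    by exists (existT _ s setT) => /=; split=> //; exact: filterT.
  move=> [t W] [t' W'] /= [st nW] [st' nW'].
  pose u := (t `|` t')%O.
  exists (existT _ u (sa_map (skel_pi_unif (leUl t t')) @^-1` W `&`
      sa_map (skel_pi_unif (leUr t' t)) @^-1` W')) => /=.
    split; first by rewrite lexU2 ?st.
    by apply: filterI; apply: sa_map_continuous; rewrite folded_proj_pi.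
  move=> _ [y' [Wy' W'y'] <-]; split; exists y' => //=.
    by rewrite -(folded_proj_pi (leUl t t')).
  by rewrite -(folded_proj_pi (leUr t' t)).
have cN : N --> (set_val y : P).
  apply/cvg_sup => i A [_ [[A' oA' <-] /= A'y] AA'].
  exists (existT _ (s `|` i)%O
    (sa_map (skel_pi_unif (leUr i s)) @^-1` A')) => /=.
    split; first exact: leUl.
    apply: sa_map_continuous; rewrite folded_proj_pi.
    exact: open_nbhs_nbhs.
  move=> _ [y' /= Ay' <-]; apply: AA' => /=.
  by move: Ay'; rewrite folded_proj_pi.
have [[t W] /= [st nW] WV] := cN V (open_nbhs_nbhs (conj oV Vy)).
exists t; split=> //; exists W => // y' Wy'; apply: VO => /=.
by apply: WV; exists y'.
Qed.

(** Both coordinates are images of the single point [folded_proj t y], with [t] the join of [s] and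
    [a s g]; an estimate on [Om t] passes to its compactification by density. *)
Lemma folded_act_eval_dist (s : B) (phi : ucfun01 R (Om s)) (g : G) (y : Y)
    (d : R) :
  (forall t (st : (s <= t)%O) (sgt : (a s g <= t)%O) (x : Om t),
    `|sval phi (skel_act sgt x) - sval phi (skel_pi st x)| <= d) ->
  `|sval (folded_proj s (folded_act Om g y)) phi -
    sval (folded_proj s y) phi| <= d.
Proof.
move=> Hd; pose t := (s `|` a s g)%O.
rewrite (folded_proj_act (leUr (a s g) s)).
rewrite -(folded_proj_pi (leUl s (a s g))) /=.
by apply: sa_eval_dist => x; exact: Hd.
Qed.

Lemma folded_act1 (y : Y) : folded_act Om 1%g y = y.
Proof.
apply: folded_eq => s; have s1s : (a s 1%g <= s)%O by rewrite jact1.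
rewrite (folded_proj_act s1s); apply: sa_map_id => x /=.
apply: (close_eq (@skel_hausdorff _ _ _ _ _ _ Om s)); apply/edist_closeP.
apply/eqP; rewrite eq_le edist_ge0 andbT.
have := skel_continuity (lexx s) s1s x.
by rewrite skel_pi_id (seminorm1 (snormP theta s)).
Qed.

(** A cast along an equality of indices is a bonding map, which frees the action axiom from
    casts. *)
Lemma ecast_skel_pi (s t : B) (e : s = t) (ts : (t <= s)%O) (x : Om s) :
  ecast u (Om u) e x = skel_pi ts x.
Proof. by case: t / e ts => ts; rewrite skel_pi_id. Qed.

Lemma folded_actM (g h : G) (y : Y) :
  folded_act Om (g * h)%g y = folded_act Om g (folded_act Om h y).
Proof.
apply: folded_eq => s.
have le1 : (a (a s g) h <= a s (g * h)%g)%O by rewrite jactM.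
rewrite (folded_proj_act (lexx (a s (g * h)%g))).
rewrite (folded_proj_act (lexx (a s g))) (folded_proj_act le1).
symmetry; apply: sa_map_comp => x; rewrite /skel_act !skel_pi_id.
by rewrite -(ecast_skel_pi (jactM a s g h)) skel_action.
Qed.

Lemma seminorm_nbhs1 (s : B) (c : R) : 0 < c ->
  \forall u \near (1%g : G), theta s u < c.
Proof.
move=> c0; have cs := seminorm_continuous (snormP theta s).
have := cvgr_dist_lt _ _ (cs 1%g) _ c0 => /(_ _).
apply: filterS => u; rewrite (seminorm1 (snormP theta s)) sub0r normrN.
exact/le_lt_trans/ler_norm.
Qed.

Lemma seminorm_nbhs (s : B) (g0 : G) (c : R) : 0 < c ->
  \forall g \near g0, theta s (g * g0^-1)%g < c.
Proof.
move=> c0; have cm : continuous (fun g : G => (g * g0^-1)%g).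
  move=> g; apply: (@continuous_comp _ _ _ (fun g : G => (g, (g0^-1)%g))
    (fun gh : G * G => (gh.1 * gh.2)%g)); last exact: mulg_continuous.
  by apply: cvg_pair; [exact: cvg_id|exact: cvg_cst].
apply: (cm g0 [set u | theta s u < c]); rewrite mulgV; exact: seminorm_nbhs1.
Qed.

Lemma folded_act_continuousl (s : B) (phi : ucfun01 R (Om s)) (d : R) : 0 < d ->
  exists2 c, 0 < c & forall u y, theta s u < c ->
    `|sval (folded_proj s (folded_act Om u y)) phi -
      sval (folded_proj s y) phi| <= d.
Proof.
move=> d0; have /unif_continuousP/(_ d d0) [c c0 cP] := (svalP phi).1.
exists c => // u y uc; apply: folded_act_eval_dist => t st sut x.
apply: ltW; rewrite distrC; apply: (cP (_, _)) => /=.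
apply: (@edist_lt_ball _ _ _ (_, _)); rewrite edist_sym.
by apply: (le_lt_trans (skel_continuity st sut x)); rewrite lte_fin.
Qed.

(** For joint continuity at [(g0, y0)], write [g = u g0]: by the continuity axiom a small
    [theta s u] changes a coordinate by at most [e / 2] uniformly in the point, and [y |-> g0 y] is
    continuous. *)
Lemma folded_flow (s0 : B) : is_flow (folded_act Om).
Proof.
split.
- have [x _] := skel_nonempty Om s0; have [y _] := folded_lift x; by exists y.
- exact: folded_compact.
- exact: folded_hausdorff.
- exact: folded_act1.
- exact: folded_actM.
apply: to_folded_continuous => s; apply: to_samuel_continuous => phi [g0 y0].
apply/cvgrPdist_le => e e0.
have cg : continuous (folded_act Om g0).
  apply: to_folded_continuous => t y.
  apply: (@continuous_comp _ _ _ (fun y : Y => folded_proj (a t g0) y)).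
    exact: folded_proj_continuous.
  exact: sa_map_continuous.
have e20 : 0 < e / 2 by rewrite divr_gt0.
have [c c0 cP] := folded_act_continuousl phi e20.
have nU := @seminorm_nbhs s g0 c c0.
have nV : \forall y \near y0,
    `|sval (folded_proj s (folded_act Om g0 y0)) phi -
      sval (folded_proj s (folded_act Om g0 y)) phi| <= e / 2.
  have ch : continuous (fun y => sval (folded_proj s (folded_act Om g0 y)) phi).
    move=> y; apply: (@continuous_comp _ _ _ (folded_act Om g0)
      (fun y : Y => sval (folded_proj s y) phi)); first exact: cg.
    apply: (@continuous_comp _ _ _ (fun y : Y => folded_proj s y)
      (fun p : Sa s => sval p phi)); first exact: folded_proj_continuous.
    exact: sa_eval_continuous.
  by have := cvgr_dist_le _ _ (ch y0) _ e20; apply.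
exists ([set g | theta s (g * g0^-1)%g < c],
  [set y | `|sval (folded_proj s (folded_act Om g0 y0)) phi -
      sval (folded_proj s (folded_act Om g0 y)) phi| <= e / 2]); first by split.
move=> [g y] /= [gc ye].
have := cP _ (folded_act Om g0 y) gc; rewrite -folded_actM mulgVK => gye.
rewrite [e]splitr -(subrKA (sval (folded_proj s (folded_act Om g0 y)) phi)).
by apply: (le_trans (ler_normD _ _)); apply: lerD => //; rewrite distrC.
Qed.

End FoldedTheory.

Lemma sa_in_continuous (R : realType) (U : uniformType) :
  continuous (@sa_in R U).
Proof.
apply: to_samuel_continuous => f.
exact: (unif_continuous_continuous (svalP f).1).
Qed.

(** * Distance functions and the extended metric *)

Section DistanceFunctions.
Context {R : realType} {X : pseudoMetricType R}.

(** For [K > 0] this is the [1 / K]-Lipschitz condition; with values in [0, 1], such a function can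
    detect distances up to [K]. *)
Definition lip_with (K : R) (phi : X -> R) : Prop :=
  forall x y, ((K * `|phi x - phi y|)%:E <= edist (x, y))%E.

Lemma lip_with_unif (K : R) (phi : X -> R) : 0 < K -> lip_with K phi ->
  unif_continuous phi.
Proof.
move=> K0 lphi; apply/unif_continuousP => e e0.
exists (K * e / 2); first by rewrite !mulr_gt0 // invr_gt0.
move=> [x y] /= bxy; rewrite /ball /= -(ltr_pM2l K0) -lte_fin.
apply: (le_lt_trans (lphi x y)); apply: (@le_lt_trans _ _ (K * e / 2)%:E).
  by apply: edist_fin => //; rewrite !mulr_gt0 // invr_gt0.
by rewrite lte_fin; rewrite gtr_pMr ?mulr_gt0 // invf_lt1 // ltr1n.
Qed.

(* The function min(1, d(-, A) / K). *)
Lemma dist_function (A : set X) (K : R) : 0 < K ->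
  exists phi : ucfun01 R X, [/\ lip_with K (sval phi),
    forall x, A x -> sval phi x = 0 &
    forall x r, r <= K -> sval phi x < r / K ->
      exists2 a, A a & (edist (x, a) < r%:E)%E].
Proof.
move=> K0.
(* Truncating before [fine] matters: [fine] would send an infinite distance to 0. *)
pose t (v : \bar R) : R := fine (mine v K%:E).
have tfin v : (0 <= v)%E -> (t v)%:E = mine v K%:E.
  move=> v0; rewrite /t fineK // ge0_fin_numE.
    by rewrite (@le_lt_trans _ _ K%:E) ?ltry // ge_min lexx orbT.
  by rewrite le_min v0 lee_fin ltW.
have t0 v : (0 <= v)%E -> 0 <= t v.
  by move=> v0; rewrite -lee_fin tfin // le_min v0 lee_fin ltW.
have tK v : (0 <= v)%E -> t v <= K.
  by move=> v0; rewrite -lee_fin tfin // ge_min lexx orbT.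
have tlip v w d : (0 <= v)%E -> (0 <= w)%E -> 0 <= d ->
    (v <= d%:E + w)%E -> t v <= d + t w.
  move=> v0 w0 d0 vw; rewrite -lee_fin EFinD !tfin //.
  rewrite /Order.min; case: ifPn => vK; case: ifPn => wK //.
  - by apply: (le_trans (ltW vK)); rewrite leeDr // lee_fin.
  - by apply: (le_trans _ vw); rewrite leNgt.
  - by rewrite leeDr // lee_fin.
pose f x := t (edist_inf A x) / K.
have fK x : K * f x = t (edist_inf A x).
  by rewrite /f mulrC divfK // gt_eqF.
have flip : lip_with K f.
  move=> x y; have [->|xy] := eqVneq (edist (x, y)) +oo%E; first exact: leey.
  have xyfin : edist (x, y) \is a fin_num.
    by rewrite ge0_fin_numE ?edist_ge0 // ltey.
  rewrite -(fineK xyfin) lee_fin -{1}(gtr0_norm K0) -normrM mulrBr !fK.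
  have d0 : 0 <= fine (edist (x, y)) by rewrite fine_ge0 ?edist_ge0.
  rewrite ler_distl; apply/andP; split.
    rewrite lerBlDl; apply: tlip; rewrite ?edist_inf_ge0 // fineK // edist_sym.
    exact: edist_inf_triangle.
  rewrite addrC; apply: tlip; rewrite ?edist_inf_ge0 // fineK //.
  exact: edist_inf_triangle.
have f01 x : 0 <= f x <= 1.
  rewrite divr_ge0 ?t0 ?(ltW K0) ?edist_inf_ge0 //=.
  by rewrite ler_pdivrMr // mul1r tK ?edist_inf_ge0.
exists (exist _ f (conj (lip_with_unif K0 flip) f01)); split=> //=.
  move=> x Ax; rewrite /f /t edist_inf0 // min_l ?mul0r //.
  by rewrite lee_fin ltW.
move=> x r rK; rewrite /f ltr_pM2r ?invr_gt0 // -lte_fin.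
rewrite tfin ?edist_inf_ge0 // gt_min.
case/orP => [|]; last by rewrite lte_fin ltNge rK.
by move=> /ereal_inf_lt [_ [y Ay <-] xy]; exists y.
Qed.

End DistanceFunctions.

Section FoldedGeometry.
Context {R : realType} {G : topologicalGroupType} {disp : Order.disp_t}
  {B : joinSemilatticeType disp} {a : join_action G B}
  {theta : seminorm_map R a} (Om : skeleton theta).
Local Notation Y := (folded Om).
Local Notation Sa s := (samuel R (Om s)).
Implicit Types s t : B.

Lemma sa_dist_lt s (p : Sa s) (x : Om s) (e d : R) (W : set (Sa s)) :
  d < e -> nbhs p W ->
  (forall z, W (sa_in R z) -> (edist (z, x) < d%:E)%E) ->
  (sa_dist p (sa_in R x) < e%:E)%E.
Proof.
move=> de nW Wd; apply: (@le_lt_trans _ _ d%:E); last by rewrite lte_fin.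
apply: ge_ereal_sup => _ [A [C [oA Ap oC Cx ->]]].
have [z [Az Wz]] := sa_in_dense (filterI (open_nbhs_nbhs (conj oA Ap)) nW).
apply: le_trans (ltW (Wd z Wz)); apply: ereal_inf_lbound.
by exists z => //; exists x.
Qed.

(** A converse to [sa_dist_lt]: if [phi] is the truncated distance to [x], then [K * sval p phi] is
    at most the extended distance from [p] to [x], and a sublevel set of [phi] is the required
    neighbourhood. The truncation level [2 * e] leaves radii up to [e] visible. *)
Lemma sa_dist_lt_nbhs s (p : Sa s) (x : Om s) (e : R) : 0 < e ->
  (sa_dist p (sa_in R x) < e%:E)%E ->
  exists2 d, d < e & exists2 W, nbhs p W &
    forall z, W (sa_in R z) -> (edist (z, x) < d%:E)%E.
Proof.
move=> e0 pxe; have K0 : 0 < 2 * e by rewrite mulr_gt0.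
have [phi [phi_lip phi0 phi_lt]] := dist_function [set x] K0.
pose K := 2 * e; pose r := K * sval p phi.
have prK : sval p phi = r / K by rewrite /r mulrC mulKf // gt_eqF.
have cphi : continuous (fun q : Sa s => sval q phi).
  exact: sa_eval_continuous.
(* The open sets [A] around [p] and [C] around [x] have distance at least [r - h], since [phi] is
   [1 / K]-Lipschitz; [h] is arbitrary. *)
have re : r < e.
  rewrite -lte_fin; apply: le_lt_trans pxe; apply/lee_subgt0Pr => h h0.
  have h2 : 0 < h / 2 / K by rewrite !divr_gt0.
  pose A := [set q : Sa s | (r - h / 2) / K < sval q phi].
  pose C := [set q : Sa s | sval q phi < h / 2 / K].
  apply: (@le_trans _ _ (ereal_inf [set edist (y, z) |
    y in @sa_in R (Om s) @^-1` A & z in @sa_in R (Om s) @^-1` C])).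
    apply: le_ereal_inf_tmp => _ [y Ay [z Cz <-]].
    apply: le_trans (phi_lip y z); rewrite -EFinB lee_fin.
    move: Ay Cz; rewrite /A /C /= ltr_pdivrMr // ltr_pdivlMr // => Ay Cz.
    have : K * (sval phi y - sval phi z) <= K * `|sval phi y - sval phi z|.
      by rewrite ler_pM2l // ler_norm.
    rewrite mulrBr; move: Ay Cz; rewrite -/K ![_ * K]mulrC.
    by move: (K * `|_|) (K * sval phi y) (K * sval phi z) => u1 u2 u3; lra.
  apply: ereal_sup_ubound; exists A, C; split=> //.
  - exact: (open_preimage cphi (@open_gt _ ((r - h / 2) / K))).
  - by rewrite /A /= prK ltr_pM2r ?invr_gt0 //; lra.
  - exact: (open_preimage cphi (@open_lt _ (h / 2 / K))).
  - by suff : sval phi x < h / 2 / K by []; rewrite phi0.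
exists ((r + e) / 2); first lra.
exists [set q : Sa s | sval q phi < (r + e) / 2 / K].
  apply: (cphi p [set v | v < (r + e) / 2 / K]).
  apply: open_nbhs_nbhs; split; first exact: open_lt.
  rewrite /= prK ltr_pM2r ?invr_gt0 //; lra.
move=> z /= zlt; have [|_ -> //] := phi_lt z ((r + e) / 2) _ zlt.
by rewrite /K; lra.
Qed.

Lemma sa_in_nbhs s (x : Om s) (e : R) : 0 < e ->
  exists W : set (Sa s), [/\ open W, W (sa_in R x) &
    forall z, W (sa_in R z) -> (edist (z, x) < e%:E)%E].
Proof.
move=> e0; have [phi [_ phi0 phi_lt]] := dist_function [set x] e0.
exists [set q : Sa s | sval q phi < e / e]; split.
- exact: (open_preimage (@sa_eval_continuous R (Om s) phi)
    (@open_lt _ (e / e))).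
- by suff : sval phi x < e / e by []; rewrite phi0 // divr_gt0.
- by move=> z Wz; have [_ -> //] := phi_lt z e (lexx e) Wz.
Qed.

Lemma sa_dist_near s (x : Om s) (e : R) : 0 < e ->
  \forall q \near sa_in R x, (sa_dist q (sa_in R x) < e%:E)%E.
Proof.
move=> e0; have e20 : 0 < e / 2 by rewrite divr_gt0.
have [W [oW Wx WP]] := sa_in_nbhs x e20.
apply: filterS (open_nbhs_nbhs (conj oW Wx)) => q Wq.
apply: (@sa_dist_lt s q x e (e / 2) W) => //.
  by rewrite gtr_pMr // invf_lt1 // ltr1n.
exact: open_nbhs_nbhs.
Qed.

(** If no translate of [y] by the finite set [F] enters the open set, then neither does any point of
    [Om u] close enough to the coordinate of [y] at [u = orbit_join a t F], against the choice of
    [F]. *)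
Lemma folded_minimal (s0 : B) : minimality_property Om ->
  minimal_flow (folded_act Om).
Proof.
move=> minOm; split; first exact: folded_flow s0.
move=> y O [w Ow] oO.
have [t [_ [W nW WO]]] := folded_nbhs s0 (open_nbhs_nbhs (conj oO Ow)).
have cT := @samuel_compact R (Om t).
have [D nD DW] :=
  compact_regular (@samuel_hausdorff R (Om t)) cT filterT nW.
pose A := @sa_in R (Om t) @^-1` D°.
have oA : open A.
  apply: open_preimage; [exact: sa_in_continuous|exact: open_interior].
have [x Ax] : A !=set0.
  by have [x Dx] := sa_in_dense (nbhs_interior nD); exists x.
have [F [_ FP]] := minOm t A oA (ex_intro _ x Ax).
have [gy [[g _ <-] Wg]] : range (folded_act Om ^~ y) `&`
    (folded_proj t @^-1` W) !=set0; last first.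
  by exists (folded_act Om g y); split; [exact: WO|exists g].
apply: contrapT => nW'.
pose u := orbit_join a t F.
(* Avoiding [closure D], and not just [W], is an open condition on [p]; for each of the finitely
   many [g] in [F] it then holds near the coordinate of [y]. *)
pose E (g : G) := [set p : Sa u | forall tgu : (a t g <= u)%O,
  ~ closure D (sa_map (skel_act_unif tgu) p)].
have nE g : g \in F -> nbhs (folded_proj u y) (E g).
  move=> gF; have [tgu|ntgu] := pselect (a t g <= u)%O; last first.
    by apply: filterE => p tgu.
  have oE : open (sa_map (skel_act_unif tgu) @^-1` (~` closure D)).
    apply: open_preimage; first exact: sa_map_continuous.
    by apply: closed_openC; exact: closed_closure.
  have : nbhs (folded_proj u y)
      (sa_map (skel_act_unif tgu) @^-1` (~` closure D)).
    apply: open_nbhs_nbhs; split=> //=; rewrite -folded_proj_act => clD.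
    by apply: nW'; exists (folded_act Om g y); split; [exists g|exact: DW].
  by apply: filterS => p /= np tgu'; rewrite (bool_irrelevance tgu' tgu).
have [x' Ex'] := sa_in_dense (filter_bigI _ nE).
have [g [tgu [gF Agx]]] := FP x'.
apply: (Ex' g gF tgu); rewrite sa_map_in; apply: subset_closure.
exact: interior_subset.
Qed.

(* [phi] is the truncated distance to the set of the points of [Om s] lying
   below a basic open subset of [V]; by part (iii) of the ED property, that set
   has distance at least [c] from the corresponding set for [V']. *)
Lemma folded_ed s (V V' : set Y) (c : R) : ed_property3 Om -> open V ->
  open V' -> 0 < c < 1 ->
  (forall u y, theta s u < c -> V y -> ~ V' (folded_act Om u y)) ->
  exists phi : ucfun01 R (Om s), [/\ lip_with 1 (sval phi),
    forall w, closure V w -> sval (folded_proj s w) phi = 0 &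
    forall w, closure V' w -> c <= sval (folded_proj s w) phi].
Proof.
move=> ed3 oV oV' /andP[c0 c1] VV'.
pose below (O : set Y) := [set x : Om s |
  exists t (st : (s <= t)%O) (x' : Om t),
  skel_pi st x' = x /\ exists2 W, nbhs (sa_in R x') W &
    forall y, W (folded_proj t y) -> O y].
(* Values of [phi] at points of the closure of [O] are approximated by its values on [below O]. *)
have belowP O w (phi : ucfun01 R (Om s)) (T : set R) : open O -> closure O w ->
    open T -> T (sval (folded_proj s w) phi) ->
    exists2 x, below O x & T (sval phi x).
  move=> oO clO oT Tw.
  have ce : continuous (fun y : Y => sval (folded_proj s y) phi).
    move=> y; apply: (@continuous_comp _ _ _ (fun y : Y => folded_proj s y)
      (fun p : Sa s => sval p phi)); first exact: folded_proj_continuous.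
    exact: sa_eval_continuous.
  have [w' [Ow' Tw']] := clO _ (ce w T (open_nbhs_nbhs (conj oT Tw))).
  have oOT : open (O `&` (fun y : Y => sval (folded_proj s y) phi) @^-1` T).
    by apply: openI => //; exact: open_preimage.
  have [t [st [W nW WO]]] := folded_nbhs s
    (open_nbhs_nbhs (conj oOT (conj Ow' Tw'))).
  have [x' Wx'] := sa_in_dense (nbhs_interior nW).
  have [y yx'] := folded_lift x'.
  exists (skel_pi st x').
    exists t, st, x'; split=> //; exists W => [|z Wz].
      apply: filterS (open_nbhs_nbhs (conj (@open_interior _ W) Wx')).
      exact: interior_subset.
    by have [] := WO z Wz.
  have [|_ /=] := WO y; first by rewrite yx'; exact: interior_subset.
  by rewrite (folded_proj_pi_in st yx').
(* Pull both neighbourhoods back to the join [t] of their indices. If [x] and [x'] were closer than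
   [c], part (iii) would give [g] with [theta s g < c] and a point over the first set moved by [g]
   over the second; a lift of it lies in [V] and is moved into [V']. *)
have sep x x' : below V x -> below V' x' -> (c%:E <= edist (x', x))%E.
  move=> [t1 [st1 [x1 [<- [W1 nW1 W1V]]]]] [t2 [st2 [x2 [<- [W2 nW2 W2V']]]]].
  rewrite leNgt; apply/negP => x12.
  pose t := (t1 `|` t2)%O.
  have t1t : (t1 <= t)%O by exact: leUl.
  have t2t : (t2 <= t)%O by exact: leUr.
  have st : (s <= t)%O by exact: le_trans t1t.
  have op t' (tt : (t' <= t)%O) (W : set (Sa t')) :
      open [set z : Om t | W° (sa_in R (skel_pi tt z))].
    apply: (@open_preimage _ _ (fun z : Om t => sa_in R (skel_pi tt z)));
      last exact: open_interior.
    move=> z; apply: (@continuous_comp _ _ _ (skel_pi tt) (@sa_in R (Om t'))).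
      exact: (unif_continuous_continuous (skel_pi_unif tt)).
    exact: sa_in_continuous.
  have [z1 _ z1x] := skel_pi_surj t1t (I : [set: Om t1] x1).
  have [z2 _ z2x] := skel_pi_surj t2t (I : [set: Om t2] x2).
  have [||||||g gc gP] := ed3 s t st c
    [set z : Om t | W1° (sa_in R (skel_pi t1t z))]
    [set z : Om t | W2° (sa_in R (skel_pi t2t z))].
  - by rewrite c0 c1.
  - exact: op.
  - by exists z1 => /=; rewrite z1x; exact: nbhs_singleton (nbhs_interior nW1).
  - exact: op.
  - by exists z2 => /=; rewrite z2x; exact: nbhs_singleton (nbhs_interior nW2).
  - apply: le_lt_trans x12; apply: ereal_inf_lbound.
    exists z1 => /=.
      by rewrite z1x; exact: nbhs_singleton (nbhs_interior nW1).
    exists z2; first by rewrite z2x; exact: nbhs_singleton (nbhs_interior nW2).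
    rewrite edist_sym -(skel_pi_comp st1 t1t st z1).
    by rewrite -(skel_pi_comp st2 t2t st z2) z1x z2x.
  have tu : (t <= t `|` a t g)%O by exact: leUl.
  have tgu : (a t g <= t `|` a t g)%O by exact: leUr.
  have [z [/= Az Cz]] := gP _ tu tgu.
  have [y yz] := folded_lift z.
  apply: (VV' g y gc).
    apply: W1V; rewrite (folded_proj_pi_in t1t (folded_proj_pi_in tu yz)).
    exact: interior_subset.
  apply: W2V'; rewrite (folded_proj_pi_in t2t (folded_proj_act_in tgu yz)).
  exact: interior_subset.
have [phi [phi_lip phi0 phi_lt]] := dist_function (below V) ltr01.
exists phi; split=> // w clw.
  apply/eqP; rewrite eq_le; have /andP[-> _] := sa_eval01 (folded_proj s w) phi.
  rewrite andbT leNgt; apply/negP => pos.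
  have [x Vx] := belowP V w phi [set r | 0 < r] oV clw (@open_gt _ _) pos.
  by rewrite /= phi0 // ltxx.
rewrite leNgt; apply/negP => neg.
have [x' V'x' /=] := belowP V' w phi [set r | r < c] oV' clw (@open_lt _ _) neg.
move=> lt; have [|x Vx] := phi_lt x' c (ltW c1); first by rewrite divr1.
by rewrite ltNge sep.
Qed.

End FoldedGeometry.

(** * From the Ramsey property to oscillation stability *)

Section Diameter.
Context {R : realType}.
Implicit Types A : set R.

(** Values in [0, 1] bound the set of differences, so [sup] does not fall back on its default
    value. *)
Lemma le_diam A x y : (forall z, A z -> 0 <= z <= 1) -> A x -> A y ->
  `|x - y| <= diam A.
Proof.
move=> A01 Ax Ay; apply: ub_le_sup; last by exists x => //; exists y.
exists 1 => _ [u /A01 /andP[u0 u1] [v /A01 /andP[v0 v1] <-]].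
by rewrite ler_norml; apply/andP; split; lra.
Qed.

Lemma diam_le A (d : R) : 0 <= d ->
  (forall x y, A x -> A y -> `|x - y| <= d) -> diam A <= d.
Proof.
move=> d0 Ad; have [[x Ax]|A0] := pselect (A !=set0).
  apply: ge_sup; first by exists `|x - x|, x => //; exists x.
  by move=> _ [u Au [v Av <-]]; exact: Ad.
suff -> : diam A = 0 by [].
rewrite /diam (_ : [set _ | _ in _ & _ in _] = set0) ?sup0 //.
by apply/seteqP; split=> // z [u Au _]; case: A0; exists u.
Qed.

End Diameter.

Section Lipschitz.
Context {R : realType} {G : topologicalGroupType} {disp : Order.disp_t}
  {B : joinSemilatticeType disp} {a : join_action G B}
  {theta : seminorm_map R a}.
Implicit Types (s : B) (f : G -> R).

Lemma lip01_unif s f : lip01 theta s setT f ->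
  unif_continuous (f : right_uniform G -> R).
Proof.
move=> [_ fl]; apply: right_unif_continuousP => d d0.
exists [set u | theta s u < d]; first exact: seminorm_nbhs1.
by move=> g h /= ghd; exact: le_lt_trans (fl g h I I) ghd.
Qed.

Lemma lip01_right s f g : lip01 theta s setT f ->
  lip01 theta s setT (fun h => f (h * g)%g).
Proof.
move=> [f01 fl]; split=> [h _|h k _ _]; first exact: f01.
by apply: le_trans (fl _ _ I I) _; rewrite invgM mulgA mulgK.
Qed.

(** Left translation conjugates the quotient of the arguments by [g], which turns the index [s] into
    [a s g]. *)
Lemma lip01_left s f g : lip01 theta s setT f ->
  lip01 theta (a s g) setT (fun h => f (g * h)%g).
Proof.
move=> [f01 fl]; split=> [h _|h k _ _]; first exact: f01.
by apply: le_trans (fl _ _ I I) _; rewrite snormJ invgM !mulgA.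
Qed.

(** A left translate of [f] is still right uniformly continuous, so the limit exists and is a
    coordinate of [p]. *)
Lemma sa_translateE s f g (p : samuel R (right_uniform G)) :
  lip01 theta s setT f ->
  exists2 F : ucfun01 R (right_uniform G), sval F = (fun h => f (g * h)%g) &
    sa_translate p f g = sval p F.
Proof.
move=> lf; have lfg := lip01_left g lf.
pose F : ucfun01 R (right_uniform G) :=
  exist _ (fun h => f (g * h)%g) (conj (lip01_unif lfg) (fun h => lf.1 _ I)).
exists F => //; have cF := sa_eval_cvg (p := p) (f := F).
exact: (cvg_lim (@Rhausdorff R) cF).
Qed.

Lemma sa_translate_cvg s f g (p : samuel R (right_uniform G)) :
  lip01 theta s setT f ->
  f (g * h)%g @[h --> sa_nbhs p] --> sa_translate p f g.
Proof.
move=> /(sa_translateE g p) [F FE ->].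
by have := sa_eval_cvg (p := p) (f := F); rewrite FE.
Qed.

Lemma sa_translate01 s f g (p : samuel R (right_uniform G)) :
  lip01 theta s setT f -> 0 <= sa_translate p f g <= 1.
Proof. by move=> /(sa_translateE g p) [F _ ->]; exact: sa_eval01. Qed.

End Lipschitz.

Section RamseyOscillation.
Context {R : realType} {G : topologicalGroupType} {disp : Order.disp_t}
  {B : joinSemilatticeType disp} {a : join_action G B}
  {theta : seminorm_map R a} {Om : skeleton theta}.
Local Notation Y := (folded Om).

Lemma strong_ramsey_ramsey : strong_ramsey_property Om -> ramsey_property Om.
Proof.
move=> H s x e d F e0 d0; have [t [S SP]] := H s x e d F e0 d0.
have [x' _] := skel_nonempty Om t; exists t, x' => f [f01 fl].
have [|h [_ hF hd]] := SP x' f; last by exists h.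
by split=> [g _|g h _ _]; [exact: f01|exact: fl].
Qed.

(** For finite [F] and [eta > 0], let [E (F, eta)] hold the [q] in [G] that solve the problem on [F]
    up to [eta]. The Ramsey property makes these sets nonempty, and a cluster point in Sa(G) of
    their images solves the full problem. *)
Lemma ramsey_oscillation_stable : minimal_flow (folded_act Om) ->
  ramsey_property Om -> finitely_oscillation_stable Om.
Proof.
move=> mY ramY y s x e f e0 lf; have flY := mY.1.
(* Nearness of [g y] to [x] with a margin [eta], expressed through a neighbourhood so that it can be
   tested at points of [Om s]. *)
pose near_x (eta : R) (g : G) := exists2 W,
  nbhs (folded_proj s (folded_act Om g y)) W &
  forall z, W (sa_in R z) -> (edist (z, x) < (e - eta)%:E)%E.
pose E (i : {fset G} * R) := [set q : G | forall g1 g2, g1 \in i.1 ->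
  g2 \in i.1 -> near_x i.2 (g1 * q)%g -> near_x i.2 (g2 * q)%g ->
  `|f (g1 * q)%g - f (g2 * q)%g| <= 2 * e + i.2].
have En0 i : 0 < i.2 -> E i !=set0.
  case: i => F eta /= eta0.
  have [t [x' x'P]] := ramY s x e eta F e0 eta0.
  have [D [oD Dx' DP]] := sa_in_nbhs x' eta0.
  have [w wx'] := folded_lift x'.
  (* Minimality brings [g0 y] close to the Ramsey witness [x']; the Ramsey property is then applied
     to the right translate of [f] by [g0], and [q = h g0]. *)
  have [|w' [Dg0 [g0 _ g0w]]] := mY.2 y (folded_proj t @^-1` D) _
      (open_preimage (@folded_proj_continuous _ _ _ _ _ _ Om t) oD).
    by exists w; rewrite /= wx'.
  rewrite /= -g0w in Dg0.
  have [h [hF hd]] := x'P _ (lip01_right g0 lf).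
  exists (h * g0)%g => g1 g2 g1F g2F n1 n2.
  (* A point [z] of [Om t] near [g0 y] is within [eta] of [x']; the margin pays for replacing [z] by
     [x']. *)
  have arr g : g \in F -> near_x eta (g * (h * g0))%g ->
      (rtranslate F h `&` near_arrows x' x e) (g * h)%g.
    move=> gF [W nW WP]; have ghF : rtranslate F h (g * h)%g by exists g.
    split=> //; have sght := hF _ ghF; exists sght.
    rewrite mulgA folded_actM (folded_proj_act sght) in nW.
    have [z [Dz Wz]] := sa_in_dense (filterI
      (open_nbhs_nbhs (conj oD Dg0)) (@sa_map_continuous R _ _ _
        (skel_act_unif sght) _ _ nW)).
    rewrite /= sa_map_in in Wz.
    apply: (le_lt_trans (edist_triangle _ (skel_act sght z) _)).
    rewrite -(subrK eta e) addrC EFinD; apply: lteD; first exact: WP.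
    apply: (le_lt_trans (skel_act_lip _ _ _)).
    by rewrite edist_sym; exact: DP.
  rewrite !mulgA /=; apply: ltW; apply: le_lt_trans hd.
  have f01 z : [set f (g * g0)%g | g in
      rtranslate F h `&` near_arrows x' x e] z -> 0 <= z <= 1.
    by move=> [g _ <-]; exact: lf.1.
  apply: (le_diam f01).
    by exists (g1 * h)%g => //; exact: arr.
  by exists (g2 * h)%g => //; exact: arr.
pose K : set_system (samuel R (right_uniform G)) :=
  filter_from [set i : {fset G} * R | 0 < i.2]
    (fun i => (@sa_in R (right_uniform G)) @` E i).
have near_le eta eta' g : eta <= eta' -> near_x eta' g -> near_x eta g.
  move=> ee' [W nW WP]; exists W => // z /WP /lt_le_trans; apply.
  by rewrite lee_fin lerB.
have PK : ProperFilter K.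
  apply: filter_from_proper; last first.
    by move=> i /En0 [q Eq]; exists (sa_in R (q : right_uniform G)), q.
  apply: filter_from_filter; first by exists (fset0, 1) => /=.
  move=> [F1 eta1] [F2 eta2] /= e10 e20.
  exists ((F1 `|` F2)%fset, Num.min eta1 eta2) => /=.
    by rewrite lt_min e10.
  move=> _ [q Eq <-]; split; exists q => // g1 g2 g1F g2F /= n1 n2.
    have le1 : Num.min eta1 eta2 <= eta1 by rewrite ge_min lexx.
    apply: le_trans (Eq g1 g2 _ _ _ _) _ => /=;
      rewrite ?inE ?g1F ?g2F ?lerD2l //; exact: near_le le1 _.
  have le2 : Num.min eta1 eta2 <= eta2 by rewrite ge_min lexx orbT.
  apply: le_trans (Eq g1 g2 _ _ _ _) _ => /=;
    rewrite ?inE ?g1F ?g2F ?orbT ?lerD2l //; exact: near_le le2 _.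
have [|p [_ Kp]] := @samuel_compact R (right_uniform G) K PK.
  exact: filterT.
exists p; apply: diam_le; first by rewrite mulr_ge0 // ltW.
move=> _ _ [g1 n1 <-] [g2 n2 <-]; apply/ler_addgt0Pr => d d0.
have d30 : 0 < d / 3 by rewrite divr_gt0.
have [d1 d1e [W1 nW1 W1P]] := sa_dist_lt_nbhs e0 n1.
have [d2 d2e [W2 nW2 W2P]] := sa_dist_lt_nbhs e0 n2.
(* One third of [d] goes to the error in [E], one to each of the two approximations of
   [sa_translate p f] by values of [f]; the other terms are the room left in the two strict distance
   inequalities. *)
pose eta := Num.min (d / 3) (Num.min (e - d1) (e - d2)).
have eta0 : 0 < eta by rewrite !lt_min d30 !subr_gt0 d1e d2e.
have etad : eta <= d / 3 by rewrite ge_min lexx.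
have eta1 : eta <= e - d1 by rewrite !ge_min lexx !orbT.
have eta2 : eta <= e - d2 by rewrite !ge_min lexx !orbT.
have Fp : Filter (sa_nbhs p) := sa_nbhs_proper p.
have ev g W :
    nbhs (folded_proj s (folded_act Om g (sa_act (folded_act Om) p y))) W ->
    \forall q \near sa_nbhs p, W° (folded_proj s (folded_act Om (g * q)%g y)).
  move=> nW.
  have ch : continuous (fun w : Y => folded_proj s (folded_act Om g w)).
    move=> w; apply: (@continuous_comp _ _ _ (folded_act Om g)
      (fun w : Y => folded_proj s w)); last exact: folded_proj_continuous.
    exact: (flow_act_continuous flY).
  have nq : sa_nbhs p [set q |
      W° (folded_proj s (folded_act Om g (folded_act Om q y)))].
    exact: (@sa_act_cvg R G _ _ p y flY _ (ch _ _ (nbhs_interior nW))).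
  by apply: filterS nq => q; rewrite /mkset folded_actM.
have evf g : \forall q \near sa_nbhs p,
    `|sa_translate p f g - f (g * q)%g| < d / 3.
  exact: (cvgr_dist_lt _ _ (sa_translate_cvg (g := g) (p := p) lf) _ d30).
have [N nN NP] := filterI (filterI (ev g1 W1 nW1) (ev g2 W2 nW2))
  (filterI (evf g1) (evf g2)).
have [|_ [[q Eq <-] Nq]] := Kp
  ((@sa_in R (right_uniform G)) @` E ([fset g1; g2]%fset, eta)) N _ nN.
  by exists ([fset g1; g2]%fset, eta).
have [[W1q W2q] [f1 f2]] := NP _ Nq.
have nearW g d' W : eta <= e - d' ->
    W° (folded_proj s (folded_act Om (g * q)%g y)) ->
    (forall z, W (sa_in R z) -> (edist (z, x) < d'%:E)%E) ->
    near_x eta (g * q)%g.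
  move=> ed' Wq WP; exists W.
    apply: filterS (@interior_subset _ W) _.
    by apply: open_nbhs_nbhs; split=> //; exact: open_interior.
  by move=> z /WP /lt_le_trans; apply; rewrite lee_fin lerBrDl -lerBrDr.
have := Eq g1 g2 _ _ (nearW g1 d1 W1 eta1 W1q W1P)
  (nearW g2 d2 W2 eta2 W2q W2P).
rewrite !inE !eqxx orbT => /(_ isT isT) /= fq.
move: f1 f2 fq etad => /=.
move: (sa_translate p f g1) (sa_translate p f g2) (f _) (f _) => u1 u2 v1 v2.
rewrite !ltr_norml !ler_norml => /andP[? ?] /andP[? ?] /andP[? ?] ?.
by apply/andP; split; lra.
Qed.

End RamseyOscillation.

(** * From oscillation stability to universality *)

Section OscillationUniversal.
Context {R : realType} {G : topologicalGroupType} {disp : Order.disp_t}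
  {B : joinSemilatticeType disp} {a : join_action G B}
  {theta : seminorm_map R a} {Om : skeleton theta}.
Local Notation Y := (folded Om).

Lemma fset_upper_bound (s : B) (S : {fset G}) :
  exists t, (s <= t)%O /\ forall g, g \in S -> (a s g <= t)%O.
Proof.
have [t [st tP]] : exists t, (s <= t)%O /\
    forall g, g \in enum_fset S -> (a s g <= t)%O; last by exists t.
elim: (enum_fset S) => [|g l [t [st tP]]]; first by exists s.
exists (t `|` a s g)%O; split=> [|h]; first by rewrite lexU2 ?st.
by rewrite inE => /orP[/eqP->|/tP ht]; [exact: leUr|rewrite lexU2 ?ht].
Qed.

(* The infimal convolution of [c f] with the semi-norm [theta s]. *)
Lemma lip01_approx (s : B) (f : G -> R) (c d : R) : 0 < c <= 1 -> 0 <= d ->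
  (forall g, 0 <= f g <= 1) ->
  (forall g h, theta s (g * h^-1)%g < c -> `|f g - f h| <= d) ->
  exists2 f', lip01 theta s setT f' & forall g, `|c * f g - f' g| <= c * d.
Proof.
move=> /andP[c0 c1] d0 f01 fd.
pose A g := range (fun h => c * f h + theta s (g * h^-1)%g).
have A0 g : lbound (A g) 0.
  move=> _ [h _ <-].
  apply: addr_ge0; last exact: seminorm_ge0 (snormP theta s) _.
  by apply: mulr_ge0; [exact: ltW|case/andP: (f01 h)].
have le1 g h : inf (A g) <= c * f h + theta s (g * h^-1)%g.
  by apply: ge_inf; [exists 0; exact: A0|exists h].
have le2 g v :
    (forall h, v <= c * f h + theta s (g * h^-1)%g) -> v <= inf (A g).
  move=> vP; apply: lb_le_inf; last by move=> _ [h _ <-].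
  by exists (c * f g + theta s (g * g^-1)%g), g.
have le3 g : inf (A g) <= c * f g.
  by have := le1 g g; rewrite mulgV (seminorm1 (snormP theta s)) addr0.
exists (fun g => inf (A g)).
  split=> [g _|g h _ _].
    rewrite le2 ?(le_trans (le3 g)) //.
      by case/andP: (f01 g) => f0 f1; rewrite mulr_ile1 // ltW.
    by move=> h; apply: A0; exists h.
  have lip g1 g2 : inf (A g1) - theta s (g1 * g2^-1)%g <= inf (A g2).
    apply: le2 => k; rewrite lerBlDr; apply: le_trans (le1 g1 k) _.
    rewrite -addrA lerD2l addrC.
    have := seminormM (snormP theta s) (g1 * g2^-1)%g (g2 * k^-1)%g.
    by rewrite mulgA mulgVK.
  rewrite ler_distl; apply/andP; split; last by rewrite -lerBlDr lip.
  have := lip h g; rewrite -(seminormV (snormP theta s)) invgM invgK.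
  by [].
move=> g; rewrite ger0_norm ?subr_ge0 // lerBlDr addrC -lerBlDr.
(* If [g] and [h] are [c]-close, [f h] is at least [f g - d]; otherwise the semi-norm alone is at
   least [c], hence at least [c * f g]. *)
apply: le2 => h; have [lt|ge] := ltP (theta s (g * h^-1)%g) c.
  have /ler_normlP [_ fgh] := fd g h lt.
  apply: (@le_trans _ _ (c * f h)); last first.
    by rewrite lerDl (seminorm_ge0 (snormP theta s)).
  by rewrite -mulrBr ler_pM2l //; lra.
have [/andP[fg0 fg1] /andP[fh0 _]] := (f01 g, f01 h).
apply: (@le_trans _ _ c).
  have : c * f g <= c by rewrite ger_pMr.
  have : 0 <= c * d by rewrite mulr_ge0 // ltW.
  by lra.
have : 0 <= c * f h by rewrite mulr_ge0 // ltW.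
by lra.
Qed.


Section OneMinimalFlow.
Context {N : topologicalType} {actN : G -> N -> N}.
Hypothesis mY : minimal_flow (folded_act Om).
Hypothesis flN : is_flow actN.
Let actZ g (z : Y * N) := (folded_act Om g z.1, actN g z.2).

Lemma closed_fst (C : set (Y * N)) : closed C -> closed (fst @` C).
Proof.
move=> clC; have flY := mY.1; have flZ := prodflow flY flN.
apply: (compact_closed (flow_hausdorff flY)); apply: continuous_compact.
  by apply: continuous_subspaceT => z; exact: cvg_fst.
exact: (subclosed_compact clC (flow_compact flZ) (@subsetT _ _)).
Qed.

Lemma minimal_set_fst (Z : set (Y * N)) : minimal_set actZ Z ->
  forall w, exists n, Z (w, n).
Proof.
move=> [clZ [z0 Zz0] iZ _] w.
have /seteqP [_ /(_ w I) [[w' n] Zwn /= <-]] : fst @` Z = setT;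
  last by exists n.
apply: (minimal_flow_closed mY); first exact: closed_fst.
  by exists z0.1, z0.
by move=> g _ [z Zz <-]; exists (actZ g z) => //; exact: iZ.
Qed.

(* The function [g |-> F (g n0)] is approximated by a Lipschitz one, and the
   limit point [(py, pn0)] it provides has a dense orbit in [Z]. *)
Lemma oscillation_fibre (y : Y) (Z : set (Y * N)) (F : N -> R) (s : B)
    (c d : R) : oscillation_stable_at y -> minimal_set actZ Z ->
  continuous F -> (forall n, 0 <= F n <= 1) ->
  0 < c <= 1 -> 0 < d ->
  (forall u n, theta s u < c -> `|F (actN u n) - F n| <= d) ->
  forall (x : Om s) w1 n1 w2 n2, Z (w1, n1) -> Z (w2, n2) ->
    folded_proj s w1 = sa_in R x -> folded_proj s w2 = sa_in R x ->
    `|F n1 - F n2| <= 6 * d.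
Proof.
move=> osc mZ cF F01 c01 d0 Fd x w1 n1 w2 n2 Z1 Z2 w1x w2x.
have [clZ _ iZ _] := mZ; have /andP[c0 c1] := c01.
have flY := mY.1; have flZ : is_flow actZ := prodflow flY flN.
have [n0 Zyn0] := minimal_set_fst mZ y.
pose f g := F (actN g n0).
have [|f' lf' ff'] := @lip01_approx s f c d c01 (ltW d0) (fun g => F01 _).
  by move=> g h /Fd-/(_ (actN h n0)); rewrite -(flow_actM flN) mulgVK.
(* At radius [c * d], stability gives oscillation [2 * (c * d)] for the translate of [f']; two
   approximation errors [c * d] and division by [c] give [4 * d], and returning to [n1] and [n2]
   costs [d] each. *)
have e0 : 0 < c * d by rewrite mulr_gt0.
have [p hp] := osc s x (c * d) f' e0 lf'.
pose y' := sa_act (folded_act Om) p y; pose n' := sa_act actN p n0.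
have Fp : ProperFilter (sa_nbhs p) := sa_nbhs_proper p.
have cy := @sa_act_cvg R G _ _ p y flY.
have cn := @sa_act_cvg R G _ _ p n0 flN.
have Zp : Z (y', n').
  apply: clZ => W [[U V] /= [nU nV] UVW].
  have cU : sa_nbhs p [set h | U (folded_act Om h y)] := cy U nU.
  have cV : sa_nbhs p [set h | V (actN h n0)] := cn V nV.
  have [h [Uh Vh]] := filter_ex (filterI cU cV).
  exists (folded_act Om h y, actN h n0); split; last exact: UVW.
  exact: (iZ h (y, n0)).
have pf g : `|c * F (actN g n') - sa_translate p f' g| <= c * d.
  apply: (@cvg_norm_le R G (sa_nbhs p)
    (fun h => c * F (actN g (actN h n0)) - f' (g * h)%g)) => //; last first.
    by move=> h; have := ff' (g * h)%g; rewrite /f (flow_actM flN).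
  apply: cvgB; last exact: sa_translate_cvg lf'.
  apply: cvgMr.
  have cg : continuous (fun n => F (actN g n)).
    move=> n; apply: (@continuous_comp _ _ _ (actN g) F).
      exact: flow_act_continuous.
    exact: cF.
  apply: (@cvg_comp _ _ _ (fun h => actN h n0) (fun n => F (actN g n))
    _ _ _ cn).
  exact: cg.
(* The orbit of [(y', n')] is dense in [Z], so one [g] approximates both coordinates of [(w, n)]. *)
have near_orbit w n : Z (w, n) -> folded_proj s w = sa_in R x -> exists g,
    folded_near_arrows y' x (c * d) g /\ `|F (actN g n') - F n| <= d.
  move=> Zw wx.
  have nU : nbhs w [set w' : Y |
      (sa_dist (folded_proj s w') (sa_in R x) < (c * d)%:E)%E].
    apply: (@folded_proj_continuous _ _ _ _ _ _ Om s w
      [set q | (sa_dist q (sa_in R x) < (c * d)%:E)%E]).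
    by rewrite wx; exact: sa_dist_near.
  have nV : nbhs n [set n' | `|F n - F n'| < d].
    by have := cvgr_dist_lt _ _ (cF n) _ d0; apply.
  have nW : nbhs (w, n) [set z : Y * N |
      (sa_dist (folded_proj s z.1) (sa_in R x) < (c * d)%:E)%E /\
      `|F n - F z.2| < d].
    by exists ([set w' : Y | (sa_dist (folded_proj s w') (sa_in R x) <
      (c * d)%:E)%E], [set n' | `|F n - F n'| < d]).
  have [g [ng dg]] := minimal_set_orbit_meets flZ mZ Zp Zw nW.
  by exists g; split; [exact: ng|rewrite distrC ltW].
have [g1 [ng1 dg1]] := near_orbit w1 n1 Z1 w1x.
have [g2 [ng2 dg2]] := near_orbit w2 n2 Z2 w2x.
have pf12 : `|sa_translate p f' g1 - sa_translate p f' g2| <= 2 * (c * d).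
  apply: le_trans hp; apply: le_diam; last first.
  - by exists g2.
  - by exists g1.
  - by move=> _ [g _ <-]; exact: sa_translate01 lf'.
have pf1 := pf g1; have {pf} pf2 := pf g2.
have F12 : `|F (actN g1 n') - F (actN g2 n')| <= 4 * d.
  rewrite -(ler_pM2l c0) -[X in X * _](gtr0_norm c0) -normrM mulrBr.
  rewrite [c * (4 * d)]mulrCA; move: pf12 pf1 pf2.
  move: (c * F _) (c * F _) (c * d) (sa_translate _ _ _) (sa_translate _ _ _).
  move=> u1 u2 v p1 p2; rewrite !ler_norml => /andP[? ?] /andP[? ?] /andP[? ?].
  by apply/andP; split; lra.
move: F12 dg1 dg2; rewrite !ler_norml => /andP[? ?] /andP[? ?] /andP[? ?].
by apply/andP; split; lra.
Qed.

(* Finitely many translates, by elements [g] of [S], of the open set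
   [F < 1 / 6] near [w] cover [Z]. Take [w1] lying over a point of [Om t], with
   [t] above every [a s g]: some translate [g w1] is then near [w] and still
   lies over a point of [Om s], where the fibres have oscillation at most
   [1 / 8]. *)
Lemma oscillation_fibre_closure (y : Y) (Z : set (Y * N)) (F : N -> R) (s : B)
    (c : R) : oscillation_stable_at y -> minimal_set actZ Z ->
  continuous F -> (forall n, 0 <= F n <= 1) ->
  0 < c <= 1 ->
  (forall u n, theta s u < c -> `|F (actN u n) - F n| <= 1 / 48) ->
  forall w n, Z (w, n) -> F n < 1 / 6 ->
    closure [set w | forall n, Z (w, n) -> F n < 1 / 3] w.
Proof.
move=> osc mZ cF F01 c01 Fd w n Zwn Fn O; rewrite nbhsE => -[O' [oO' O'w] O'O].
have [clZ _ iZ _] := mZ.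
have flY := mY.1; have flZ : is_flow actZ := prodflow flY flN.
have oW : open [set z : Y * N | O' z.1 /\ F z.2 < 1 / 6].
  apply: (@openI _ (fst @^-1` O') (snd @^-1` [set n | F n < 1 / 6])).
    by apply: open_preimage => // z; exact: cvg_fst.
  apply: (@open_preimage _ _ snd); first by move=> z; exact: cvg_snd.
  exact: (open_preimage cF (@open_lt _ (1 / 6))).
have [S SP] := minimal_set_finite_cover flZ mZ Zwn oW (conj O'w Fn).
have [t [st tS]] := fset_upper_bound s S.
have [x _] := skel_nonempty Om t; have [w1 w1x] := folded_lift x.
have [n1 Zwn1] := minimal_set_fst mZ w1.
have [g gS [O'gw Fgn]] := SP _ Zwn1.
exists (folded_act Om g w1); split; last exact: O'O.
move=> m Zm.
have gx := folded_proj_act_in (tS g gS) w1x.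
have d0 : 0 < 1 / 48 :> R by rewrite divr_gt0.
(* The constants fit: [6 * (1 / 48) = 1 / 8] and [1 / 6 + 1 / 8 < 1 / 3]. *)
have := oscillation_fibre osc mZ cF F01 c01 d0 Fd (iZ g _ Zwn1) Zm gx gx.
rewrite /= in Fgn *; rewrite ler_norml => /andP[? ?]; lra.
Qed.


(** The complement is the projection to [Y] of a closed subset of a compact product. *)
Lemma open_fibre_lt (Z : set (Y * N)) (F : N -> R) (r : R) : closed Z ->
  continuous F -> open [set w | forall n, Z (w, n) -> F n < r].
Proof.
move=> clZ cF.
have -> : [set w | forall n, Z (w, n) -> F n < r] =
    ~` (fst @` (Z `&` snd @^-1` [set n | r <= F n])).
  apply/seteqP; split=> [w wr [[w' n] [Zwn /= rF] ww']|w nw n Zwn].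
    by rewrite /= in ww'; subst w'; have := wr n Zwn; rewrite ltNge rF.
  by rewrite ltNge; apply/negP => rF; apply: nw; exists (w, n).
apply: closed_openC; apply: closed_fst; apply: closedI => //.
apply: (@closed_preimage _ _ snd); first by move=> z; exact: cvg_snd.
exact: (closed_preimage cF (@closed_ge _ r)).
Qed.

(** Separate [n] from [n'] by [F]. Then [w] is in the closure of both open sets where, on whole
    fibres, [F < 1 / 3] and [F > 2 / 3] respectively. A small [u] changes [F] by at most [1 / 48],
    so it cannot move the first set into the second, and [folded_ed] keeps the closures disjoint. *)
Lemma oscillation_fibre_unique (y : Y) (Z : set (Y * N)) :
  seminorm_base (range theta) -> ed_property3 Om -> oscillation_stable_at y ->
  minimal_set actZ Z -> forall w n n', Z (w, n) -> Z (w, n') -> n = n'.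
Proof.
have gap (r1 r2 : R) : `|r1 - r2| <= 1 / 48 -> 1 - r1 < 1 / 3 -> r2 < 1 / 3 ->
    False by rewrite ler_norml => /andP[? ?]; lra.
move=> base ed3 osc mZ w n n' Zn Zn'; apply: contrapT => nn'.
have [clZ _ iZ _] := mZ.
have [F [cF F01 Fn Fn']] :=
  compact_Urysohn R (flow_compact flN) (flow_hausdorff flN) nn'.
have d0 : 0 < 1 / 48 :> R by rewrite divr_gt0.
have /base.2 [_ [c [[s _ <-] c0 cU]]] := flow_equicontinuous flN cF d0.
pose c' := Num.min c (1 / 2).
have c'01 : 0 < c' < 1.
  rewrite /c' lt_min c0 gt_min; apply/andP; split; first by rewrite divr_gt0.
  by apply/orP; right; lra.
have /andP[c'0 c'1] := c'01.
have Fd u m : theta s u < c' -> `|F (actN u m) - F m| <= 1 / 48.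
  by rewrite lt_min => /andP[uc _]; exact: ltW (cU u uc m).
pose F' m := 1 - F m.
have cF' : continuous F'.
  by move=> m; apply: cvgB; [exact: cvg_cst|exact: cF].
have F'01 m : 0 <= F' m <= 1.
  by have /andP[? ?] := F01 m; rewrite /F'; apply/andP; split; lra.
have Fd' u m : theta s u < c' -> `|F' (actN u m) - F' m| <= 1 / 48.
  by move=> /Fd-/(_ m); rewrite /F' distrC; congr (`|_| <= _); lra.
have c'01' : 0 < c' <= 1 by rewrite c'0 ltW.
have clV : closure [set w | forall n, Z (w, n) -> F n < 1 / 3] w.
  apply: (oscillation_fibre_closure osc mZ cF F01 c'01' Fd Zn).
  by rewrite Fn; lra.
have clV' : closure [set w | forall n, Z (w, n) -> F' n < 1 / 3] w.
  apply: (oscillation_fibre_closure osc mZ cF' F'01 c'01' Fd' Zn').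
  by rewrite /F' Fn'; lra.
have [u v uc Vv V'uv|phi [_ phi0 phic]] := @folded_ed _ _ _ _ _ _ Om s _ _ c'
    ed3 (@open_fibre_lt Z F (1 / 3) clZ cF)
    (@open_fibre_lt Z F' (1 / 3) clZ cF') c'01.
- have [m Zm] := minimal_set_fst mZ v.
  exact: gap (Fd u m uc) (V'uv _ (iZ u _ Zm)) (Vv m Zm).
- by have := phic w clV'; rewrite phi0 // leNgt c'0.
Qed.

End OneMinimalFlow.

Lemma oscillation_universal (y : Y) : seminorm_base (range theta) ->
  ed_property3 Om -> minimal_flow (folded_act Om) ->
  oscillation_stable_at y -> universal_minimal_flow (folded_act Om).
Proof.
move=> base ed3 mY osc; split=> // N actN mN.
have [flY flN] := (mY.1, mN.1); have flZ := prodflow flY flN.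
have [|//|Z _ mZ] := exists_minimal_set flZ closedT.
  exact: flow_nonempty flZ.
have Zu := oscillation_fibre_unique mY flN base ed3 osc mZ.
have [clZ [z0 Zz0] iZ _] := mZ.
have Zf := minimal_set_fst mY flN mZ.
pose f w := projT1 (cid (Zf w)); have fP w : Z (w, f w) := projT2 (cid (Zf w)).
have cf : continuous f.
  apply: (closed_graph_continuous (flow_compact flN) (flow_hausdorff flN)
    clZ fP).
  by move=> w n Zwn; exact: Zu (fP w).
have ef : equivariant (folded_act Om) actN f.
  by move=> g w; apply: Zu (fP _) _; exact: (iZ g (w, f w)).
exists f; split=> // n _; have [w fw] := equivariant_surj mN flY cf ef n.
by exists w.
Qed.

End OscillationUniversal.

(** * From universality to the strong Ramsey property *)

Section LipschitzFlow.
Context {R : realType} {G : topologicalGroupType} {disp : Order.disp_t}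
  {B : joinSemilatticeType disp} {a : join_action G B}
  {theta : seminorm_map R a} (s : B).
Local Notation RG := (prod_topology (fun _ : G => R)).

Lemma closed_lip01 (D : set G) : closed [set f : RG | lip01 theta s D f].
Proof.
have ev g : continuous (fun f : RG => f g).
  exact: (@prod_topology_proj_continuous G (fun _ => R) g).
have -> : [set f : RG | lip01 theta s D f] =
    \bigcap_(g in D) ((fun f : RG => f g) @^-1` `[0, 1]%classic `&`
    \bigcap_(h in D) [set f : RG | `|f g - f h| <= theta s (g * h^-1)%g]).
  apply/seteqP; split=> [f [f01 fl] g Dg|f fD].
    by split=> [|h Dh]; [rewrite /= in_itv; exact: f01|exact: fl].
  split=> [g Dg|g h Dg Dh]; have [f01 fl] := fD g Dg; last exact: fl.
  by move: f01; rewrite /= in_itv.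
apply: closed_bigI => g _; apply: closedI.
  apply: closed_preimage; first exact: ev.
  exact: itv_closed.
by apply: closed_bigI => h _; exact: (closed_dist_le (ev g) (ev h)).
Qed.

(** The space C_s(G, [0, 1]) with pointwise convergence, on which [G] acts by right translation of
    the argument. *)
Definition lip_space : Type := set_type [set f : RG | lip01 theta s setT f].

HB.instance Definition _ := Topological.copy lip_space
  (set_type [set f : RG | lip01 theta s setT f]).

Definition lip_act (g : G) (f : lip_space) : lip_space :=
  exist _ (fun h => sval f (h * g)%g)
    (mem_set (lip01_right g (set_mem (svalP f)))).

Lemma lip_eval_continuous (g : G) : continuous (fun f : lip_space => sval f g).
Proof.
move=> f; apply: (@continuous_comp _ _ _ (fun f : lip_space => set_val f)
  (fun f : RG => f g)).
  exact: initial_continuous.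
exact: prod_topology_proj_continuous.
Qed.

Lemma compact_unit_functions : compact [set f : RG | forall g, 0 <= f g <= 1].
Proof.
exact: (@prod_topology_compact G (fun _ => R) (fun _ => `[0, 1]%classic)
  (fun _ => @segment_compact R 0 1)).
Qed.

Lemma lip_flow : is_flow lip_act.
Proof.
split.
- have l0 : lip01 theta s setT (fun _ : G => 0).
    split=> [g _|g h _ _]; first by rewrite lexx ler01.
    by rewrite subrr normr0; exact: seminorm_ge0 (snormP theta s) _.
  by exists (exist _ (fun _ => 0) (mem_set l0) : lip_space).
- apply: compact_set_type.
  apply: (subclosed_compact (@closed_lip01 setT) compact_unit_functions).
  by move=> f [f01 _] g; exact: f01.
- by apply/hausdorff_set_type/prod_topology_hausdorff => _; exact: Rhausdorff.
- by move=> f; apply: val_inj; apply/funext => h /=; rewrite mulg1.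
- by move=> g h f; apply: val_inj; apply/funext => k /=; rewrite mulgA.
apply: to_set_type_continuous; apply: prod_topology_continuous => k [g0 f0].
apply/cvgrPdist_le => e e0; have e20 : 0 < e / 2 by rewrite divr_gt0.
(* The index [a s k] appears because comparing [f] at [k * g] and [k * g0] conjugates [g * g0^-1] by
   [k]. *)
have nU := @seminorm_nbhs _ _ _ _ _ theta (a s k) g0 _ e20.
have nV : \forall f \near f0,
    `|sval f0 (k * g0)%g - sval f (k * g0)%g| <= e / 2.
  by have := cvgr_dist_le _ _ (@lip_eval_continuous (k * g0)%g f0) _ e20; apply.
exists ([set g | theta (a s k) (g * g0^-1)%g < e / 2],
  [set f : lip_space | `|sval f0 (k * g0)%g - sval f (k * g0)%g| <= e / 2]).
  by split.
move=> [g f] /= [gk fk].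
have [_ fl] := set_mem (svalP f).
have fg : `|sval f (k * g0)%g - sval f (k * g)%g| <= e / 2.
  rewrite distrC; apply: le_trans (fl _ _ I I) _; apply: le_trans (ltW gk).
  by rewrite snormJ invgM !mulgA.
suff : `|sval f0 (k * g0)%g - sval f (k * g)%g| <= e by [].
rewrite [e]splitr -(subrKA (sval f (k * g0)%g)).
by apply: (le_trans (ler_normD _ _)); apply: lerD.
Qed.

End LipschitzFlow.

Section UniversalRamsey.
Context {R : realType} {G : topologicalGroupType} {disp : Order.disp_t}
  {B : joinSemilatticeType disp} {a : join_action G B}
  {theta : seminorm_map R a} {Om : skeleton theta}.
Local Notation Y := (folded Om).
Local Notation RG := (prod_topology (fun _ : G => R)).

(* A pair (y, f) for which [h] does not witness the Ramsey property: being near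
   a common point of [Om s] is relaxed to a condition closed in [y]. *)
Definition oscillates (s : B) (F : {fset G}) (e d : R) (h : G)
    (z : Y * RG) : Prop :=
  exists g1 g2, [/\ g1 \in F, g2 \in F,
    d <= `|z.2 (g1 * h)%g - z.2 (g2 * h)%g| &
    forall phi : ucfun01 R (Om s), lip_with 1 (sval phi) ->
      `|sval (folded_proj s (folded_act Om (g1 * h)%g z.1)) phi -
        sval (folded_proj s (folded_act Om (g2 * h)%g z.1)) phi| <= e].

Lemma closed_oscillates (flY : is_flow (folded_act Om)) s F e d h :
  closed [set z | oscillates s F e d h z].
Proof.
pose E (g : G * G) := [set z : Y * RG |
  d <= `|z.2 (g.1 * h)%g - z.2 (g.2 * h)%g|] `&`
  \bigcap_(phi in [set phi : ucfun01 R (Om s) | lip_with 1 (sval phi)])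
    [set z | `|sval (folded_proj s (folded_act Om (g.1 * h)%g z.1)) phi -
      sval (folded_proj s (folded_act Om (g.2 * h)%g z.1)) phi| <= e].
have -> : [set z | oscillates s F e d h z] =
    \bigcup_(g1 in [set` F]) \bigcup_(g2 in [set` F]) E (g1, g2).
  apply/seteqP; split=> z.
    by move=> [g1 [g2 [g1F g2F zd ze]]]; exists g1 => //; exists g2.
  by move=> [g1 g1F [g2 g2F [zd ze]]]; exists g1, g2.
apply: closed_bigcup => // g1 _; apply: closed_bigcup => // g2 _.
apply: closedI.
  have ev g : continuous (fun z : Y * RG => z.2 g).
    move=> z; apply: (@continuous_comp _ _ _ (@snd Y RG) (fun f : RG => f g)).
      exact: cvg_snd.
    exact: prod_topology_proj_continuous.
  exact: closed_dist_ge.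
apply: closed_bigI => phi _.
have ev g : continuous (fun z : Y * RG =>
    sval (folded_proj s (folded_act Om g z.1)) phi).
  move=> z; apply: (@continuous_comp _ _ _ (@fst Y RG)
    (fun y : Y => sval (folded_proj s (folded_act Om g y)) phi)).
    exact: cvg_fst.
  apply: (@continuous_comp _ _ _ (folded_act Om g)
    (fun y : Y => sval (folded_proj s y) phi)).
    exact: (flow_act_continuous flY).
  apply: (@continuous_comp _ _ _ (fun y : Y => folded_proj s y)
    (fun p => sval p phi)); first exact: folded_proj_continuous.
  exact: sa_eval_continuous.
exact: (closed_dist_le (ev (g1 * h)%g) (ev (g2 * h)%g)).
Qed.

(** Each pair [(t, S)] has a counterexample, which gives a point of the closed set [C (t, S)] in a
    compact space. These sets are directed by joins and unions, and a common point oscillates for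
    every [h]. *)
Lemma not_strong_ramsey_oscillates (flY : is_flow (folded_act Om)) (s : B)
    (x : Om s) (e d : R) (F : {fset G}) : 0 < e -> 0 < d ->
  ~ (exists (t : B) (S : {fset G}), forall (x' : Om t) f,
    lip01 theta s [set (g * h)%g | g in [set` F] & h in [set` S]] f ->
    exists h : G, [/\ h \in S, rtranslate F h `<=` arrows a t s &
      diam (f @` (rtranslate F h `&` near_arrows x' x e)) < 2 * e + d]) ->
  exists z : Y * RG, lip01 theta s setT z.2 /\
    forall h, oscillates s F (2 * e) (2 * e + d / 2) h z.
Proof.
move=> e0 d0 nR.
(* For empty [F] the diameter is that of the empty set, which is 0, so the property cannot fail. *)
have [g0 g0F] : exists g, g \in F.
  apply: contrapT => F0; apply: nR; exists s, [fset 1%g]%fset => x' f _.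
  have noF h : rtranslate F h = set0.
    by apply/seteqP; split=> // k [g gF _]; case: F0; exists g.
  exists 1%g; split; rewrite ?noF ?inE //.
  apply: (@le_lt_trans _ _ 0); last by rewrite addr_gt0 // mulr_gt0.
  by apply: diam_le => // u v [g []].
pose FS (S : {fset G}) := [set (g * h)%g | g in [set` F] & h in [set` S]].
pose C (i : B * {fset G}) := [set z : Y * RG | lip01 theta s (FS i.2) z.2 /\
  forall h, h \in i.2 -> rtranslate F h `<=` arrows a i.1 s ->
    oscillates s F (2 * e) (2 * e + d / 2) h z].
pose unit01 : set (Y * RG) :=
  [set: Y] `*` [set f : RG | forall g, 0 <= f g <= 1].
have Cn0 i : C i `&` unit01 !=set0.
  case: i => t S; have [x' [f [lf fP]]] : exists (x' : Om t) f,
      lip01 theta s (FS S) f /\ forall h, h \in S ->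
        rtranslate F h `<=` arrows a t s ->
        2 * e + d <= diam (f @` (rtranslate F h `&` near_arrows x' x e)).
    apply: contrapT => nx; apply: nR; exists t, S => x' f lf.
    apply: contrapT => nh; apply: nx; exists x', f; split=> // h hS hF.
    by rewrite leNgt; apply/negP => lt; apply: nh; exists h.
  have [y yx'] := folded_lift x'.
  (* The extension by 0 is Lipschitz only on [FS S]; this is all that [C (t, S)] asks for, and in
     the limit [S] exhausts [G]. *)
  pose f1 : RG := fun g => if `[< FS S g >] then f g else 0.
  have f1E g : FS S g -> f1 g = f g by move=> FSg; rewrite /f1 asboolT.
  exists (y, f1); split; last first.
    split=> // g /=; rewrite /f1; have [FSg|nFSg] := pselect (FS S g).
      by rewrite asboolT //; exact: lf.1.
    by rewrite asboolF // lexx ler01.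
  split=> [|h hS hF].
    split=> [g FSg|g h FSg FSh]; rewrite /= !f1E //; first exact: lf.1.
    exact: lf.2.
  (* The diameter need not be attained, hence the loss of [d / 2]. *)
  have d12 : 2 * e + d / 2 < 2 * e + d.
    by rewrite ltrD2l gtr_pMr // invf_lt1 // ltr1n.
  have := lt_le_trans d12 (fP h hS hF); rewrite ltNge => /negP nd.
  apply: contrapT => nosc; apply: nd; apply: diam_le.
    by rewrite addr_ge0 ?mulr_ge0 ?divr_ge0 ?(ltW e0) ?(ltW d0).
  move=> _ _ [_ [[g1 g1F <-] [s1 n1]] <-] [_ [[g2 g2F <-] [s2 n2]] <-].
  rewrite leNgt; apply/negP => gt; apply: nosc; exists g1, g2; split=> //.
    rewrite /= !f1E ?ltW //; first by exists g2 => //; exists h.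
    by exists g1 => //; exists h.
  move=> phi phi_lip.
  rewrite [folded_proj s (folded_act Om (g1 * h)%g _)]
    (folded_proj_act_in s1 yx').
  rewrite [folded_proj s (folded_act Om (g2 * h)%g _)]
    (folded_proj_act_in s2 yx').
  rewrite -lee_fin.
  have := phi_lip (skel_act s1 x') (skel_act s2 x'); rewrite mul1r => le12.
  apply: (le_trans le12); apply: (le_trans (edist_triangle _ x _)).
  rewrite mulr_natl mulr2n EFinD; apply: leeD; first exact: ltW.
  by rewrite edist_sym ltW.
pose K : set_system (Y * RG) := filter_from setT (fun i => C i `&` unit01).
have PK : ProperFilter K.
  apply: filter_from_proper; last by move=> i _; exact: Cn0.
  apply: filter_from_filter; first by exists (s, fset0).
  move=> [t S] [t' S'] _ _; exists ((t `|` t')%O, (S `|` S')%fset) => //.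
  have FSl g : FS S g -> FS (S `|` S')%fset g.
    by move=> [g1 g1F [h hS <-]]; exists g1 => //; exists h; rewrite //= inE hS.
  have FSr g : FS S' g -> FS (S `|` S')%fset g.
    move=> [g1 g1F [h hS <-]]; exists g1 => //.
    by exists h; rewrite //= inE hS orbT.
  move=> z [[[z01 zl] zo] z1]; split; split=> //; split=> /=.
  - by split=> [g /FSl|g h /FSl FSg /FSl FSh]; [exact: z01|exact: zl].
  - move=> h hS hF; apply: zo => /=; first by rewrite inE hS.
    by move=> g /hF /le_trans; apply; exact: leUl.
  - by split=> [g /FSr|g h /FSr FSg /FSr FSh]; [exact: z01|exact: zl].
  - move=> h hS hF; apply: zo => /=; first by rewrite inE hS orbT.
    by move=> g /hF /le_trans; apply; exact: leUr.
have cU : compact unit01.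
  apply: compact_setX; first exact: (flow_compact flY).
  exact: compact_unit_functions.
have clC i : closed (C i).
  have -> : C i = snd @^-1` [set f : RG | lip01 theta s (FS i.2) f] `&`
    \bigcap_(h in [set h | h \in i.2 /\ rtranslate F h `<=` arrows a i.1 s])
      [set z | oscillates s F (2 * e) (2 * e + d / 2) h z].
    apply/seteqP; split=> z [zl zo]; split=> // h; first by case; exact: zo.
    by move=> hS hF; exact: zo.
  apply: closedI; last by apply: closed_bigI => h _; exact: closed_oscillates.
  apply: closed_preimage; last exact: closed_lip01.
  by move=> z; exact: cvg_snd.
have [|z [_ Kz]] := cU K PK.
  by exists (s, fset0) => // z [].
have Cz i : C i z.
  by apply: clC => W nW; apply: Kz nW; exists i => // z' [].
exists z; split.
  (* As [g0] is in [F], any two elements of [G] lie in [FS S] for a suitable two-element [S]. *)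
  have gk g : exists k : G, (g0 * k)%g = g.
    by exists (g0^-1 * g)%g; rewrite mulgA mulgV mul1g.
  split=> [g _|g h _ _].
    have [k <-] := gk g; apply: (Cz (s, [fset k]%fset)).1.1; exists g0 => //.
    by exists k => //=; exact: fset11.
  have [[k <-] [l <-]] := (gk g, gk h).
  apply: (Cz (s, [fset k; l]%fset)).1.2; exists g0 => //.
    by exists k => //=; exact: fset21.
  by exists l => //=; exact: fset22.
move=> h; have [t [_ tP]] :=
  fset_upper_bound (a := a) s [fset (g * h)%g | g in F]%fset.
apply: ((Cz (t, [fset h]%fset)).2 h) => /=; first exact: fset11.
by move=> _ [g gF <-]; apply: tP; apply/imfsetP; exists g.
Qed.

Lemma universal_strong_ramsey : ed_property3 Om ->
  universal_minimal_flow (folded_act Om) -> strong_ramsey_property Om.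
Proof.
move=> ed3 uY s x e d F e0 d0; have [mY _] := uY; have flY := mY.1.
apply: contrapT => /(not_strong_ramsey_oscillates flY e0 d0).
move=> [[y0 f0] [lf0 osc0]].
pose K := lip_space (theta := theta) s.
pose act g (z : Y * K) := (folded_act Om g z.1, lip_act g z.2).
have flZ : is_flow act := prodflow flY (@lip_flow _ _ _ _ _ theta s).
pose forget (z : Y * K) : Y * RG := (z.1, sval z.2).
pose D := [set z : Y * K | forall h,
  oscillates s F (2 * e) (2 * e + d / 2) h (forget z)].
have iD : invariant_set act D.
  move=> g z Dz h; have [g1 [g2 [g1F g2F zd ze]]] := Dz (h * g)%g.
  exists g1, g2; split=> //; first by rewrite /= -!mulgA.
  by move=> phi /ze; rewrite !mulgA !(folded_actM _ g).
have clD : closed D.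
  have -> : D = \bigcap_(h in setT) (forget @^-1`
      [set z | oscillates s F (2 * e) (2 * e + d / 2) h z]).
    by apply/seteqP; split=> z Dz h; [move=> _; exact: Dz|exact: Dz].
  apply: closed_bigI => h _.
  apply: closed_preimage; last exact: closed_oscillates.
  have cval : continuous (fun z : Y * K => set_val z.2).
    move=> z.
    apply: (@continuous_comp _ _ _ (@snd Y K) (fun f : K => set_val f)).
      exact: cvg_snd.
    exact: initial_continuous.
  by apply: (@continuous_pair _ _ RG _ _ _ cval) => z; exact: cvg_fst.
have nD : D !=set0 by exists (y0, exist _ f0 (mem_set lf0)).
have flD := subflow flZ iD clD nD.
have cq : continuous (fun z : set_type D => (sval z).1).
  move=> z; apply: (@continuous_comp _ _ _ (@set_val _ D) (@fst Y K)).
    exact: set_val_continuous.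
  exact: cvg_fst.
have [sec [csec esec secK]] := universal_section uY flD cq (fun _ _ => erefl).
(* By equivariance the function carried by [sec y] is [g |-> Psi (g y)], so a single continuous
   function on [Y] records them all. *)
pose Psi y := sval (sval (sec y)).2 1%g.
have PsiE y g : Psi (folded_act Om g y) = sval (sval (sec y)).2 g.
  by rewrite /Psi esec /= mul1g.
have cPsi : continuous Psi.
  move=> y; apply: (@continuous_comp _ _ _ (fun y => set_val (sec y))
    (fun z : Y * K => sval z.2 1%g)).
    apply: (@continuous_comp _ _ _ sec (@set_val _ D)); first exact: csec.
    exact: set_val_continuous.
  apply: (@continuous_comp _ _ _ (@snd Y K) (fun f : K => sval f 1%g)).
    exact: cvg_snd.
  exact: lip_eval_continuous.
have [Psi01 Psil] : (forall y, 0 <= Psi y <= 1) /\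
    forall u y, `|Psi (folded_act Om u y) - Psi y| <= theta s u.
  have lipP y := set_mem (svalP (sval (sec y)).2).
  split=> [y|u y]; first exact: (lipP y).1.
  rewrite PsiE -{2}(folded_act1 y) PsiE.
  by apply: le_trans ((lipP y).2 _ _ I I) _; rewrite invg1 mulg1.
(* The section takes values in [D]. At [h = 1] this gives two points of [Y] at which [Psi] differs
   by at least [2 * e + d / 2], while 1-Lipschitz functions of the [s] coordinate differ by at most
   [2 * e]. *)
have [g1 [g2 [_ _ osc Dphi]]] := set_mem (svalP (sec y0)) 1%g.
rewrite /forget in Dphi; rewrite /= in osc.
rewrite -!PsiE in osc.
have secy0 : (sval (sec y0)).1 = y0 by exact: secK.
rewrite secy0 in Dphi.
move: osc Dphi.
move: (folded_act Om (g1 * 1)%g y0) (folded_act Om (g2 * 1)%g y0) => w1 w2.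
wlog le12 : w1 w2 / Psi w1 <= Psi w2 => [hw|].
  have /orP[/hw|/hw h] := le_total (Psi w1) (Psi w2); first exact.
  by rewrite distrC => osc Dphi; apply: h => // phi /Dphi; rewrite distrC.
rewrite distrC ger0_norm ?subr_ge0 // => osc Dphi.
have /andP[p10 _] := Psi01 w1; have /andP[_ p21] := Psi01 w2.
(* As [Psi] has values in [0, 1], [2 * e < 1], so [c] fits strictly between [2 * e] and 1. It also
   stays below [2 * e + d / 2 - d / 8], the gap left after both level sets are widened by [d / 16],
   so [u] with [theta s u < c] cannot move one into the other. *)
pose c := Num.min ((1 + 2 * e) / 2) (2 * e + d / 4).
have c1 : c <= (1 + 2 * e) / 2 by rewrite ge_min lexx.
have c2 : c <= 2 * e + d / 4 by rewrite ge_min lexx orbT.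
have ec : 2 * e < c by rewrite lt_min; apply/andP; split; lra.
have c01 : 0 < c < 1 by apply/andP; split; lra.
have o1 : open [set y | Psi y < Psi w1 + d / 16].
  exact: (open_preimage cPsi (@open_lt _ (Psi w1 + d / 16))).
have o2 : open [set y | Psi w2 - d / 16 < Psi y].
  exact: (open_preimage cPsi (@open_gt _ (Psi w2 - d / 16))).
have [u v uc /= v1 v2|phi [phi_lip phi0 phic]] :=
    @folded_ed _ _ _ _ _ _ Om s _ _ c ed3 o1 o2 c01.
  by have := Psil u v; rewrite ler_norml => /andP[_ ?]; lra.
have := Dphi phi phi_lip; rewrite phi0; last first.
  by apply: subset_closure; rewrite /= ltrDl divr_gt0.
rewrite sub0r normrN => le2e.
have cw2 : c <= sval (folded_proj s w2) phi.
  by apply: phic; apply: subset_closure; rewrite /= ltrBlDr ltrDl divr_gt0.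
have := le_trans cw2 (le_trans (ler_norm _) le2e).
by rewrite leNgt ec.
Qed.

End UniversalRamsey.

(** * Invariance under isomorphism and the equivalences *)

Lemma universal_minimal_flow_iso (G : topologicalGroupType)
    (X M : topologicalType) (actX : G -> X -> X) (actM : G -> M -> M) :
  minimal_flow actX -> universal_minimal_flow actM -> flow_iso actX actM ->
  universal_minimal_flow actX.
Proof.
move=> mX [mM uM] [f [[cf [f' [fK f'K cf']]] ef]]; split=> // N actN mN.
have [h [ch eh sh]] := uM N actN mN; exists (h \o f); split.
- by move=> x; apply: continuous_comp; [exact: cf|exact: ch].
- by move=> g x /=; rewrite ef eh.
- move=> n _; have [m _ hm] := sh n I; exists (f' m) => //=.
  by rewrite f'K.
Qed.

Theorem theorem9p19 (R : realType) (G : topologicalGroupType)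
    (G_hausdorff : hausdorff_space G)
    (disp : Order.disp_t) (B : joinSemilatticeType disp)
    (a : join_action G B) (theta : seminorm_map R a)
    (theta_base : seminorm_base (range theta))
    (Om : skeleton theta)
    (Om_ED : ed_property Om) (Om_minimal : minimality_property Om) :
  [<-> ramsey_property Om;
       strong_ramsey_property Om;
       finitely_oscillation_stable Om;
       weakly_finitely_oscillation_stable Om;
       exists (M : topologicalType) (actM : G -> M -> M),
         universal_minimal_flow actM /\ flow_iso (folded_act Om) actM].
Proof.
have [_ _ ed3] := Om_ED.
(* A base of semi-norms has at least one member, which provides an index in [B]. *)
have [_ [c [[s0 _ _] _ _]]] := (theta_base.2 setT).1 filterT.
have mY := folded_minimal s0 Om_minimal.
have r3 : ramsey_property Om -> finitely_oscillation_stable Om.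
  exact: ramsey_oscillation_stable mY.
have r34 : finitely_oscillation_stable Om ->
    weakly_finitely_oscillation_stable Om.
  by have [y _] := flow_nonempty mY.1; exists y.
have r4u : weakly_finitely_oscillation_stable Om ->
    universal_minimal_flow (folded_act Om).
  by move=> [y osc]; exact: oscillation_universal theta_base ed3 mY osc.
have ru2 : universal_minimal_flow (folded_act Om) -> strong_ramsey_property Om.
  exact: universal_strong_ramsey.
tfae.
(* The strong form is reached from the Ramsey property by the detour through oscillation stability
   and universality. *)
- by move=> /r3 /r34 /r4u /ru2.
- by move=> /strong_ramsey_ramsey /r3.
- exact: r34.
- move=> /r4u uY; exists (folded Om), (folded_act Om); split=> //.
  exists id; split=> //; split; first by move=> y; exact: cvg_id.
  by exists id; split=> // y; exact: cvg_id.
- move=> [M [actM [uM iso]]]; apply: strong_ramsey_ramsey; apply: ru2.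
  exact: universal_minimal_flow_iso mY uM iso.
Qed.
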